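(* Let $X_0,X_1$ be Banach spaces with $X_1\subset X_0$ continuously, let $\widetilde{X}_1$ be a closed subspace of $X_1$, let $\theta_0\in\,]0,1[$, and let $\Pi: X_1\to X_1/\widetilde{X}_1$ be the canonical projection. Let $1\le p\le\infty$. Assume that $\widetilde{X}_1$ is exactly of order $\theta_0$. Then for every $\theta\in\,]\theta_0,1[$ the map $\Pi$ extends to a continuous linear map $[X_0,X_1]_{\theta,p}\to X_1/\widetilde{X}_1$ (still denoted $\Pi$). Moreover, for $\theta\in\,]0,1[$, $\theta\ne\theta_0$, $$[X_0,\widetilde{X}_1]_{\theta,p}=\begin{cases}[X_0,X_1]_{\theta,p}, & \theta<\theta_0,\\ [X_0,X_1]_{\theta,p}\cap \mathrm{Ker}(\Pi), & \theta>\theta_0,\end{cases}$$ where $\mathrm{Ker}(\Pi)$ denotes the kernel of the extension of $\Pi$.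
   Context: $A\sim B$ means $C_1A\le B\le C_2A$ with positive constants $C_1,C_2$ independent of all parameters; $A\lesssim B$ means $A\le CB$ similarly. The subspace $\widetilde{X}_1$ carries the norm of $X_1$, and $X_1/\widetilde{X}_1$ the quotient norm. For $u\in X_1$, $t>0$, set $J(t,u)=\|u\|_{X_0}+t\|u\|_{X_1}$, and define the quotient $J$ norm $N_J(t,u)=\inf_{v\in\widetilde{X}_1}J(t,u-v)$. The subspace $\widetilde{X}_1$ is said to be exactly of order $\theta_0$ if $$N_J(t,u)\sim t^{\theta_0}\|u\|_{X_1/\widetilde{X}_1}$$ with constants independent of $u\in X_1$ and $t\in\,]0,1]$. $[X_0,X_1]_{\theta,p}$ ($0<\theta<1$, $1\le p\le\infty$) is the real interpolation space: with $K(t,u)=\inf\{\|u_0\|_{X_0}+t\|u_1\|_{X_1}: u=u_0+u_1,\ u_0\in X_0,\ u_1\in X_1\}$, it is the set of $u\in X_0$ such that $\|t^{-\theta}K(t,u)\|_{L^p(]0,\infty[,dt/t)}<\infty$, with this norm. The space $[X_0,\widetilde{X}_1]_{\theta,p}$ is defined in the same way with $\widetilde{X}_1$ in place of $X_1$. *)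

(* Defs.v *)
From HB Require Import structures.
From mathcomp Require Import all_boot all_order all_algebra.
From mathcomp Require Import all_classical all_reals all_analysis.
From mathcomp Require Import measurable_realfun generic_quotient ring_quotient.
From mathcomp Require Import complex.

Set Implicit Arguments.
Unset Strict Implicit.
Unset Printing Implicit Defensive.

Import Order.TTheory GRing.Theory Num.Theory.
Import numFieldNormedType.Exports.

Local Open Scope classical_set_scope.
Local Open Scope ring_scope.

Variant scalar_kind := RealScalars | ComplexScalars.

Definition scalars (R : realType) (k : scalar_kind) : numFieldType :=
  match k with
  | RealScalars => R
  | ComplexScalars => R[i]
  end.

(* MathComp-Analysis norms take their values in the field of scalars; the value
   of a norm is a nonnegative real number, which is extracted here. *)
Definition real_value (R : realType) (k : scalar_kind) : scalars R k -> R :=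
  match k with
  | RealScalars => fun a : R => a
  | ComplexScalars => fun a : R[i] => complex.Re a
  end.

Definition nrm (R : realType) (k : scalar_kind)
  (V : normedModType (scalars R k)) (x : V) : R := real_value `|x|.

Section Quotient.
Variables (K : pzRingType) (V : lmodType K) (S : submodClosed V).

Definition subspace_pred : {pred V} := S.

Lemma subspace_zmod_closed : zmod_closed subspace_pred.
Proof.
rewrite /subspace_pred; split=> [|x y xS yS]; first exact: rpred0.
by rewrite rpredD// -scaleN1r rpredZ.
Qed.

HB.instance Definition _ :=
  GRing.isZmodClosed.Build V subspace_pred subspace_zmod_closed.

Definition quotient_space : Type := Quotient.quot subspace_pred.
HB.instance Definition _ := GRing.Zmodule.on quotient_space.

Definition qproj (x : V) : quotient_space := (\pi_(Quotient.quot subspace_pred) x)%qT.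

Definition quotient_scale (a : K) (q : quotient_space) : quotient_space :=
  qproj (a *: repr (q : Quotient.quot subspace_pred)).

Lemma qproj_eq (x y : V) : (qproj x = qproj y) <-> (x - y \in S).
Proof. by rewrite (Quotient.idealrBE subspace_pred); split => [/eqP|/eqP]. Qed.

Lemma qprojD : {morph qproj : x y / x + y}.
Proof. by move=> x y; rewrite /qproj !piE. Qed.

Lemma qproj_repr (q : quotient_space) : qproj (repr (q : Quotient.quot subspace_pred)) = q.
Proof. exact: reprK. Qed.

Lemma quotient_scaleE a x : quotient_scale a (qproj x) = qproj (a *: x).
Proof.
apply/qproj_eq; rewrite -scalerBr rpredZ//.
by apply/qproj_eq; rewrite qproj_repr.
Qed.

Fact quotient_scaleA a b q :
  quotient_scale a (quotient_scale b q) = quotient_scale (a * b) q.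
Proof. by rewrite -(qproj_repr q) !quotient_scaleE scalerA. Qed.

Fact quotient_scale1 : left_id 1 quotient_scale.
Proof. by move=> q; rewrite -(qproj_repr q) quotient_scaleE scale1r. Qed.

Fact quotient_scaleDr : right_distributive quotient_scale +%R.
Proof.
move=> a q r; rewrite -(qproj_repr q) -(qproj_repr r) -qprojD !quotient_scaleE.
by rewrite -qprojD scalerDr.
Qed.

Fact quotient_scaleDl q : {morph quotient_scale^~ q : a b / a + b}.
Proof.
by move=> a b; rewrite -(qproj_repr q) !quotient_scaleE -qprojD scalerDl.
Qed.

HB.instance Definition _ := GRing.Zmodule_isLmodule.Build K quotient_space
  quotient_scaleA quotient_scale1 quotient_scaleDr quotient_scaleDl.
End Quotient.

Section LogMeasure.
Context (R : realType).
Local Open Scope ereal_scope.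

Definition dt_over_t (A : set R) : \bar R :=
  \int[lebesgue_measure]_(t in A `&` `]0%R, +oo[%classic) (t^-1)%:E.

Let dt_over_t0 : dt_over_t set0 = 0.
Proof. by rewrite /dt_over_t set0I integral_set0. Qed.

Let inv_ge0 (A : set R) t : (A `&` `]0%R, +oo[%classic) t -> 0 <= (t^-1)%:E.
Proof. by case=> _ /=; rewrite in_itv/= andbT lee_fin invr_ge0 => /ltW. Qed.

Let dt_over_t_ge0 A : 0 <= dt_over_t A.
Proof. by apply: integral_ge0 => t; exact: inv_ge0. Qed.

Let dt_over_t_sigma_additive : semi_sigma_additive dt_over_t.
Proof.
move=> /= A mA tA mUA; rewrite /dt_over_t setI_bigcupl.
have mAI i : measurable (A i `&` `]0%R, +oo[%classic) by exact: measurableI.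
rewrite ge0_integral_bigcup//=; last 3 first.
- rewrite -setI_bigcupl.
  have mV : measurable_fun (`]0%R, +oo[%classic : set R) (fun t : R => (t^-1)%:E).
    apply/measurable_EFinP; apply: open_continuous_measurable_fun => // t.
    rewrite inE/= in_itv/= andbT => t0.
    by apply: inv_continuous; rewrite gt_eqF.
  by apply: (measurable_funS _ _ mV) => //; exact: subIsetr.
- by move=> t [n _]; exact: inv_ge0.
- exact: trivIset_setIr.
by apply: is_cvg_ereal_nneg_natsum_cond => n _ _; exact: dt_over_t_ge0.
Qed.

HB.instance Definition _ := isMeasure.Build _ _ _ dt_over_t
  dt_over_t0 dt_over_t_ge0 dt_over_t_sigma_additive.

End LogMeasure.

Section Interpolation.
Variables (R : realType) (k : scalar_kind).
Variables (X0 X1 : normedModType (scalars R k)) (iota : {linear X1 -> X0}).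

(* A subspace Y of X1, with the norm of X1, plays the role of the second space
   of the couple; Y = setT gives the couple (X0, X1) itself.  The inclusion of
   X1 in X0 is the injection iota. *)
Definition K_functional (Y : set X1) (t : R) (u : X0) : R :=
  inf [set r | exists u0 u1,
         [/\ Y u1, u = u0 + iota u1 & r = nrm u0 + t * nrm u1]].

Definition interp_norm (Y : set X1) (theta : R) (p : \bar R) (u : X0) : \bar R :=
  Lnorm (@dt_over_t R) p (fun t => (t `^ (- theta) * K_functional Y t u)%:E).

Definition interp_space (Y : set X1) (theta : R) (p : \bar R) : set X0 :=
  [set u | (interp_norm Y theta p u < +oo)%E].

Definition J_functional (t : R) (u : X1) : R := nrm (iota u) + t * nrm u.

Variable S : submodClosed X1.

Definition quotient_norm (q : quotient_space S) : R :=
  inf [set r | exists2 x, qproj S x = q & r = nrm x].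

Definition quotient_J (t : R) (u : X1) : R :=
  inf [set r | exists2 v, v \in S & r = J_functional t (u - v)].

Definition exactly_of_order (theta0 : R) : Prop :=
  exists C1 C2 : R, [/\ 0 < C1, 0 < C2 &
    forall (t : R) (u : X1), 0 < t <= 1 ->
      C1 * quotient_J t u <= t `^ theta0 * quotient_norm (qproj S u)
                          <= C2 * quotient_J t u].

(* P is a total function on X0, but only its restriction to
   [X0, X1]_{theta, p} matters. *)
Definition continuous_linear_extension (theta : R) (p : \bar R)
    (P : X0 -> quotient_space S) : Prop :=
  let E := interp_space setT theta p in
  let normE := interp_norm setT theta p in
  [/\ forall u : X1, P (iota u) = qproj S u,
      forall (a : scalars R k) (u v : X0), E u -> E v ->
        P (a *: u + v) = a *: P u + P v
    & forall u, E u -> forall e : R, 0 < e -> exists2 d : R, 0 < d &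
        forall v, E v -> (normE (v - u)%R < d%:E)%E ->
          quotient_norm (P v - P u) < e].

Definition equivalent_norms_on (E : set X0) (N N' : X0 -> \bar R) : Prop :=
  exists C1 C2 : R, [/\ 0 < C1, 0 < C2 &
    forall u, E u -> (C1%:E * N u <= N' u <= C2%:E * N u)%E].

(* Equality of normed spaces, as usual in interpolation theory: the same
   elements, with equivalent norms. *)
Definition same_normed_space (E : set X0) (N : X0 -> \bar R)
    (E' : set X0) (N' : X0 -> \bar R) : Prop :=
  E = E' /\ equivalent_norms_on E N N'.

End Interpolation.

(* Main.v *)
Require Import Defs.
From HB Require Import structures.
From mathcomp Require Import all_boot all_order all_algebra.
From mathcomp Require Import all_classical all_reals all_analysis.
From mathcomp Require Import measurable_realfun ess_sup_inf ring lra complex.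

Set Implicit Arguments.
Unset Strict Implicit.
Unset Printing Implicit Defensive.

Import Order.TTheory GRing.Theory Num.Theory.
Import numFieldNormedType.Exports.

Local Open Scope classical_set_scope.
Local Open Scope ring_scope.

(** The two halves of the exact order are used in opposite directions: the
    quotient norm of [u] in [X1] is at most [C t^(-theta0)] times the J-functional
    of [u] at [t], and conversely [u] can be corrected by an element of [S] so
    that its J-functional at [t] is at most [C t^theta0] times its quotient norm.
    Write [K] and [KS] for the K-functionals of the couples [(X0, X1)] and
    [(X0, S)]; clearly [K <= KS], and all the content is in a converse.

    Applying both halves to nearly optimal decompositions of [u] at the scales
    [t] and [l t] yields, for every [l > 0], the recurrence ([K_recurrence])

      [KS(t, u) <= A_l K(t, u) + C l^(-theta0) KS(l t, u)],

    where [C] does not depend on [l].  After multiplication by [t^(-theta)] the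
    last coefficient becomes [C l^(theta - theta0)], which is at most 1/2 if [l]
    is small (when [theta > theta0]) or large (when [theta < theta0]).  Iterating
    along the orbit [l^n t] bounds [t^(-theta) KS(t, u)] by a geometric sum of
    dilates of [t^(-theta) K(t, u)], provided that the remainder vanishes; since
    dt/t is invariant under dilations, the weighted L^p norms are then comparable
    ([Lnorm_absorb_dilation], [interp_norm_subspace_le]).  For [theta < theta0]
    the orbit goes to infinity and the remainder vanishes without any condition.
    For [theta > theta0] the orbit goes to 0, and one needs that
    [KS(t, u) = O(t^theta)] near 0.

    This last condition is what the kernel of the trace provides.  If
    [K(t, u) = O(t^theta)] with [theta > theta0], a telescoping argument over
    dyadic scales produces [x] in [X1] with [KS(t, u - x) = O(t^theta)]
    ([K_functional_lift]), and an element of [X1] with such a decay lies in [S]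
    ([K_functional_order_gt]).  Hence the class of [x] modulo [S] is determined
    by [u]; it is the trace of [u], it depends linearly on [u], its norm is
    controlled by that of [u], and when it vanishes [x] is in [S] and [u] itself
    satisfies the condition. *)

(** * The real norm of a space over the real or complex numbers *)
Section RealValuedNorm.
Context {R : realType} {k : scalar_kind}.
Local Notation K := (scalars R k).

Definition scalar_of_real : R -> K :=
  match k return R -> scalars R k with
  | RealScalars => fun r : R => r
  | ComplexScalars => fun r : R => r%:C%C
  end.

Lemma real_value_scalar (r : R) : real_value (scalar_of_real r) = r.
Proof. by rewrite /real_value /scalar_of_real; case: k. Qed.

Lemma scalar_of_real_le (a b : R) :
  (scalar_of_real a <= scalar_of_real b) = (a <= b).
Proof. by rewrite /scalar_of_real; case: k => //; exact: lecR. Qed.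

Lemma scalar_of_real_lt (a b : R) :
  (scalar_of_real a < scalar_of_real b) = (a < b).
Proof. by rewrite /scalar_of_real; case: k => //; exact: ltcR. Qed.

Lemma scalar_of_real0 : scalar_of_real 0 = 0.
Proof. by rewrite /scalar_of_real; case: k. Qed.

Lemma scalar_of_realD (a b : R) :
  scalar_of_real (a + b) = scalar_of_real a + scalar_of_real b.
Proof. by rewrite /scalar_of_real; case: k => //; exact: rmorphD. Qed.

Lemma scalar_of_realM (a b : R) :
  scalar_of_real (a * b) = scalar_of_real a * scalar_of_real b.
Proof. by rewrite /scalar_of_real; case: k => //; exact: rmorphM. Qed.

(** The order on complex numbers only compares numbers with equal imaginary
    parts, so a nonnegative scalar is real; this transports every inequality
    between norms, and every radius of a ball, to the real numbers. *)
Lemma scalar_of_real_nonneg (a : K) : 0 <= a -> a = scalar_of_real (real_value a).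
Proof.
rewrite /scalar_of_real /real_value; move: a; case: k => //= -[x y].
by rewrite lecE/= => /andP[/eqP -> _].
Qed.

Context {V : normedModType K}.
Implicit Types x y : V.

Lemma normr_nrm x : `|x| = scalar_of_real (nrm x).
Proof. exact: scalar_of_real_nonneg. Qed.

Lemma nrm_ge0 x : 0 <= nrm x.
Proof. by rewrite -scalar_of_real_le -normr_nrm scalar_of_real0. Qed.

Lemma nrm0 : nrm (0 : V) = 0.
Proof. by rewrite /nrm normr0 -scalar_of_real0 real_value_scalar. Qed.

Lemma nrmD x y : nrm (x + y) <= nrm x + nrm y.
Proof.
by rewrite -scalar_of_real_le scalar_of_realD -!normr_nrm ler_normD.
Qed.

Lemma nrmN x : nrm (- x) = nrm x.
Proof. by rewrite /nrm normrN. Qed.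

Lemma nrmB x y : nrm (x - y) <= nrm x + nrm y.
Proof. by rewrite -(nrmN y) nrmD. Qed.

Lemma nrm_distC x y : nrm (x - y) = nrm (y - x).
Proof. by rewrite -nrmN opprB. Qed.

Lemma nrmZ (a : K) x : nrm (a *: x) = real_value `|a| * nrm x.
Proof.
by rewrite {1}/nrm normrZ normr_nrm (scalar_of_real_nonneg (normr_ge0 a))
  -scalar_of_realM !real_value_scalar.
Qed.

Lemma real_value_norm_ge0 (a : K) : 0 <= real_value `|a|.
Proof.
by rewrite -scalar_of_real_le -scalar_of_real_nonneg// scalar_of_real0.
Qed.

Lemma ball_nrm x (e : R) : ball x (scalar_of_real e) = [set y | nrm (x - y) < e].
Proof.
by rewrite -ball_normE; apply/seteqP; split => y /=;
  rewrite normr_nrm scalar_of_real_lt.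
Qed.

Lemma closed_nrm (A : set V) x : closed A ->
  (forall e : R, 0 < e -> exists2 y, A y & nrm (x - y) < e) -> A x.
Proof.
move=> clA Ax; apply: clA => B /nbhs_ballP[e /= e0 eB].
have := scalar_of_real_nonneg (ltW e0) => eE.
have [|y Ay xy] := Ax (real_value e).
  by rewrite -scalar_of_real_lt -eE scalar_of_real0.
by exists y; split => //; apply: eB; rewrite eE ball_nrm.
Qed.

End RealValuedNorm.

Lemma continuous_linear_nrm (R : realType) (k : scalar_kind)
    (V W : normedModType (scalars R k)) (f : {linear V -> W}) : continuous f ->
  exists2 L : R, 1 <= L & forall x, nrm (f x) <= L * nrm x.
Proof.
move=> /linear_bounded_continuous/linear_boundedP/pinfty_ex_gt0[M M0 fM].
have ME := scalar_of_real_nonneg (ltW M0).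
have M1 : 0 <= real_value M by rewrite -(@scalar_of_real_le R k) -ME
  scalar_of_real0 ltW.
exists (1 + real_value M) => [|x]; first by rewrite lerDl.
have := fM x; rewrite !normr_nrm ME -scalar_of_realM scalar_of_real_le.
by move=> /le_trans; apply; rewrite real_value_scalar ler_wpM2r ?nrm_ge0// lerDr.
Qed.

Lemma geometric_cvg_nrm (R : realType) (k : scalar_kind)
    (V : completeNormedModType (scalars R k)) (x : nat -> V) (c rho : R) :
  0 <= c -> 0 <= rho < 1 ->
  (forall n, nrm (x n.+1 - x n) <= c * rho ^+ n) ->
  exists y, forall n, nrm (y - x n) <= c / (1 - rho) * rho ^+ n.
Proof.
move=> c0 /andP[rho0 rho1] xc.
have r1 : 0 < 1 - rho by rewrite subr_gt0.
set d := c / (1 - rho).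
have d0 : 0 <= d by rewrite divr_ge0// ltW.
have xmn n j : nrm (x (n + j)%N - x n) <= d * rho ^+ n - d * rho ^+ (n + j).
  elim: j => [|j IHj]; first by rewrite addn0 !subrr nrm0.
  rewrite addnS (_ : _ - _ = (x (n + j).+1 - x (n + j)%N) + (x (n + j)%N - x n)).
    apply: le_trans (nrmD _ _) _; apply: le_trans (lerD (xc _) IHj) _.
    rewrite addrC -addrA lerD2l exprS.
    have -> : c = d * (1 - rho) by rewrite /d divfK// gt_eqF.
    by rewrite le_eqVlt; apply/orP; left; apply/eqP; ring.
  by rewrite addrA subrK.
have xle n j : nrm (x (n + j)%N - x n) <= d * rho ^+ n.
  by apply: le_trans (xmn n j) _; rewrite gerBl mulr_ge0// exprn_ge0.
have small (e : R) : 0 < e -> exists n, d * rho ^+ n < e.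
  move=> e0; have : (fun n => d * rho ^+ n) @ \oo --> d * 0.
    by apply: cvgMr; apply: cvg_expr; rewrite ger0_norm.
  rewrite mulr0 => /cvgrPdist_lt/(_ e e0)[n _ /(_ n (leqnn n))] /=.
  rewrite sub0r normrN ger0_norm; last by rewrite mulr_ge0// exprn_ge0.
  by exists n.
have : cauchy (x @ \oo).
  apply: cauchy_exP => e e0.
  have eE := scalar_of_real_nonneg (ltW e0).
  have [|n dn] := small (real_value e).
    by rewrite -(@scalar_of_real_lt R k) -eE scalar_of_real0.
  exists (x n); exists n => // m /= /subnKC <-.
  by rewrite eE ball_nrm/= nrm_distC (le_lt_trans (xle _ _)).
move=> /cauchy_cvgP/cvg_ex[y xy]; exists y => n.
apply/ler_addgt0Pr => e e0.
have ball_e : nbhs y (ball y (@scalar_of_real R k e)).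
  by apply: nbhsx_ballx; rewrite -(@scalar_of_real0 R k) scalar_of_real_lt.
have [N _ /(_ (n + N)%N (leq_addl _ _))] := xy _ ball_e.
rewrite /= ball_nrm/= => yN.
rewrite (_ : y - x n = (y - x (n + N)%N) + (x (n + N)%N - x n)).
  by rewrite addrC; apply: le_trans (nrmD _ _) (lerD (xle _ _) (ltW yN)).
by rewrite addrA subrK.
Qed.

(** * Dilation invariance of the measure dt/t *)
Section MultiplicativeHaarMeasure.
Context {R : realType}.
Local Notation leb := (@lebesgue_measure R).
Local Notation haar := (@dt_over_t R).
Implicit Types (l t : R) (A : set R).
Local Open Scope ereal_scope.

Lemma measurable_dilation l : measurable_fun [set: R] ( *%R l : R -> R).
Proof. exact: measurable_funM. Qed.

(** The type of Lebesgue measure carries its own copy of the Borel sigma-algebra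
    of the line, and [dt_over_t] uses the default one; hence two definitions. *)
Definition dilated_lebesgue l : {measure set (measurableTypeR R) -> \bar R} :=
  measure_function_pushforward__canonical__measure_function_Measure
    lebesgue_measure
    (measurable_dilation l : measurable_fun setT
      ( *%R l : measurableTypeR R -> measurableTypeR R)).

Definition dilated_haar l : {measure set R -> \bar R} :=
  measure_function_pushforward__canonical__measure_function_Measure
    haar (measurable_dilation l).

Lemma lebesgue_measure_dilation l A : (0 < l)%R -> measurable A ->
  leb A = l%:E * leb ( *%R l @^-1` A).
Proof.
move=> l0 mA.
pose mu : {measure set (measurableTypeR R) -> \bar R} :=
  mscale (NngNum (ltW l0)) (dilated_lebesgue l).
rewrite -[RHS]/(mu A); apply: lebesgue_measure_unique => //= _ [[a b]] _ <-.
rewrite /mu /= /mscale /= /pushforward.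
have -> : *%R l @^-1` `]a, b]%classic = `](l^-1 * a)%R, (l^-1 * b)%R]%classic.
  apply/seteqP; split => t /=; rewrite !in_itv/=.
    by rewrite ltr_pdivrMl// ler_pdivlMl.
  by rewrite ltr_pdivrMl// ler_pdivlMl.
rewrite !lebesgue_measure_itv/= !lte_fin ltr_pM2l ?invr_gt0//.
case: ifP => ab; last by rewrite mule0.
rewrite -!EFinB -EFinM; congr (_%:E).
by rewrite -mulrBr mulrA mulfV ?mul1r// gt_eqF.
Qed.

Lemma measurable_inv_pos :
  measurable_fun (`]0%R, +oo[%classic : set R) (fun t => (t^-1)%:E).
Proof.
apply/measurable_EFinP; apply: open_continuous_measurable_fun => // t.
rewrite inE/= in_itv/= andbT => t0.
by apply: inv_continuous; rewrite gt_eqF.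
Qed.

(** On the multiplicative group of positive reals, dt/t is the Haar measure:
    the factor by which a dilation multiplies Lebesgue measure is cancelled by
    the density 1/t. *)
Lemma haar_dilation l A : (0 < l)%R -> measurable A ->
  haar ( *%R l @^-1` A) = haar A.
Proof.
move=> l0 mA; rewrite /dt_over_t.
have mAp : measurable (A `&` `]0%R, +oo[%classic) by exact: measurableI.
have pos : *%R l @^-1` A `&` `]0%R, +oo[%classic =
    *%R l @^-1` (A `&` `]0%R, +oo[%classic).
  apply/seteqP; split => t /=; rewrite !in_itv/= !andbT.
    by move=> [? ?]; split => //; exact: mulr_gt0.
  by move=> [? ]; rewrite pmulr_rgt0.
have m1 : measurable_fun (A `&` `]0%R, +oo[%classic) (fun t : R => (t^-1)%:E).
  by apply: measurable_funS measurable_inv_pos => //; exact: subIsetr.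
have ge1 t : (A `&` `]0%R, +oo[%classic) t -> 0 <= (t^-1)%:E.
  by move=> -[_ /=]; rewrite in_itv/= andbT lee_fin invr_ge0 => /ltW.
pose nu : {measure set (measurableTypeR R) -> \bar R} :=
  mscale (NngNum (ltW l0)) (dilated_lebesgue l).
rewrite [RHS](@eq_measure_integral _ _ _ _ nu); last first.
  by move=> B mB _; exact: (lebesgue_measure_dilation l0 mB).
rewrite [RHS]ge0_integral_mscale//.
rewrite [X in _ = _ * X]ge0_integral_pushforward//; last first.
  by move=> t /[!inE]; exact: ge1.
have mP : measurable ( *%R l @^-1` (A `&` `]0%R, +oo[%classic)).
  by rewrite -[X in measurable X]setTI; exact: measurable_dilation.
rewrite -ge0_integralZl_EFin//=; last 3 first.
- by move=> t tA; exact: ge1 tA.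
- apply: (measurable_comp mAp) m1 _ => [_ [t tA <-]//|].
  exact: measurable_funTS (measurable_dilation l).
- exact: ltW.
rewrite pos; apply: eq_integral => t _.
by rewrite -EFinM invfM mulrA mulfV ?mul1r// gt_eqF.
Qed.

Lemma haar_nonpos : haar `]-oo, 0%R] = 0.
Proof.
rewrite /dt_over_t (_ : _ `&` _ = set0) ?integral_set0//.
apply/seteqP; split => t //= []; rewrite !in_itv/= andbT => ?.
by rewrite ltNge => /negP.
Qed.

Lemma haar_ae_pos : {ae haar, forall t, (0 < t)%R}.
Proof.
exists `]-oo, 0%R]%classic; split => //; first exact: haar_nonpos.
by move=> t /= tN; rewrite in_itv/= leNgt; apply/negP.
Qed.

Lemma ae_dilation l (Q : R -> Prop) : (0 < l)%R ->
  {ae haar, forall t, Q t} -> {ae haar, forall t, Q (l * t)%R}.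
Proof.
move=> l0 [N [mN N0 QN]]; exists ( *%R l @^-1` N); split.
- by rewrite -[X in measurable X]setTI; exact: measurable_dilation.
- by rewrite -[RHS]N0; exact: haar_dilation.
- by move=> t; exact: (QN (l * t)%R).
Qed.

Lemma ge0_integral_dilation l (f : R -> \bar R) : (0 < l)%R ->
  measurable_fun setT f -> (forall t, 0 <= f t) ->
  \int[haar]_t f (l * t)%R = \int[haar]_t f t.
Proof.
move=> l0 mf f0.
transitivity (\int[dilated_haar l]_t f t); last first.
  by apply: eq_measure_integral => B mB _; exact: haar_dilation.
by rewrite ge0_integral_pushforward.
Qed.

Lemma haar_doubling_ge t : (0 < t)%R -> (2^-1)%:E <= haar `[t, (2 * t)%R].
Proof.
move=> t0; rewrite /dt_over_t.
have -> : `[t, (2 * t)%R]%classic `&` `]0%R, +oo[%classic = `[t, (2 * t)%R]%classic.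
  apply/setIidl => s /=; rewrite !in_itv/= andbT => /andP[+ _].
  exact: lt_le_trans.
apply: (@le_trans _ _ (\int[leb]_(s in `[t, (2 * t)%R]) (cst ((2 * t)^-1)%:E s))).
  rewrite integral_cst//= lebesgue_measure_itv/= lte_fin ltr_pMl ?ltr1n//.
  rewrite -EFinB -EFinM lee_fin le_eqVlt; apply/orP; left; apply/eqP.
  by field; rewrite gt_eqF.
apply: ge0_le_integral => //=.
- by move=> s _; rewrite lee_fin invr_ge0 mulr_ge0// ltW.
- apply: measurable_funS measurable_inv_pos => //.
  move=> s /=; rewrite !in_itv/= andbT => /andP[+ _].
  exact: lt_le_trans.
- move=> s /=; rewrite !in_itv/= => /andP[ts s2].
  by rewrite lee_fin lef_pV2// posrE ?mulr_gt0// (lt_le_trans t0).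
Qed.

Lemma haarT_gt0 : 0 < haar setT.
Proof.
apply: (@lt_le_trans _ _ (haar `[1%R, (2 * 1)%R])).
  exact: lt_le_trans (haar_doubling_ge ltr01).
by apply: le_measure; rewrite ?inE.
Qed.

End MultiplicativeHaarMeasure.

(** * L^p estimates along dilations *)
Section LnormDilation.
Context {R : realType}.
Local Notation haar := (@dt_over_t R).
Implicit Types (l t A m : R) (f g : R -> R).

Lemma powR_half_convex (r x y : R) : 1 <= r -> 0 <= x -> 0 <= y ->
  (2^-1 * x + 2^-1 * y) `^ r <= 2^-1 * x `^ r + 2^-1 * y `^ r.
Proof.
move=> r1 x0 y0; rewrite {2 4}(_ : 2^-1 = 1 - 2^-1 :> R); last by lra.
by apply: (convex_powR r1 (Itv01 _ _)) => //=;
  rewrite ?inE/= ?in_itv/= ?andbT ?invr_ge0// invf_le1 ?ler1n.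
Qed.

Lemma le_of_geometric_error (rho x y B : R) : 0 <= rho < 1 ->
  (forall n, x <= y + rho ^+ n * B) -> x <= y.
Proof.
move=> /andP[rho0 rho1] xy.
have cv : (fun n => y + rho ^+ n * B) @ \oo --> y + 0 * B.
  apply: cvgD; first exact: cvg_cst.
  by apply: cvgMl; apply: cvg_expr; rewrite ger0_norm.
rewrite mul0r addr0 in cv; rewrite -(cvg_lim _ cv)//.
apply: limr_ge; first by apply/cvg_ex; exists y.
exact: nearW.
Qed.

Lemma half01 : 0 <= (2^-1 : R) < 1.
Proof. by rewrite invr_ge0 ler0n invf_lt1 ?ltr1n ?ltr0n. Qed.

Lemma iterate_half_recursion (a b : R^nat) n :
  (forall j, b j <= a j + 2^-1 * b j.+1) ->
  b 0 <= \sum_(j < n) 2^-1 ^+ j * a j + 2^-1 ^+ n * b n.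
Proof.
move=> ab; elim: n => [|n /le_trans]; first by rewrite big_ord0 add0r mul1r.
apply; rewrite big_ord_recr/= -addrA lerD2l exprSr -mulrA -mulrDr.
by rewrite ler_wpM2l// exprn_ge0// invr_ge0.
Qed.

Lemma sum_half_le2 n : \sum_(j < n) 2^-1 ^+ j <= 2 :> R.
Proof.
suff -> : \sum_(j < n) 2^-1 ^+ j = 2 - 2 * 2^-1 ^+ n :> R.
  by rewrite gerBl mulr_ge0// exprn_ge0// invr_ge0.
elim: n => [|n IHn]; first by rewrite big_ord0 expr0; lra.
by rewrite big_ord_recr/= IHn exprS; lra.
Qed.

Lemma Lnorm_EFin (r : R) f : Lnorm haar r%:E (EFin \o f) =
  ((\int[haar]_t (`|f t| `^ r)%:E) `^ r^-1)%E.
Proof. by rewrite unlock; congr (_ `^ _)%E; apply: eq_integral => t _ /=. Qed.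

Lemma Lnorm_le_of_integral (r c : R) (f g : R -> R) : 0 < r -> 0 <= c ->
  (\int[haar]_t (`|g t| `^ r)%:E <=
     (c `^ r)%:E * \int[haar]_t (`|f t| `^ r)%:E)%E ->
  (Lnorm haar r%:E (EFin \o g) <= c%:E * Lnorm haar r%:E (EFin \o f))%E.
Proof.
move=> r0 c0 le_int; rewrite !Lnorm_EFin.
have ge0 (h : R -> R) : (0 <= \int[haar]_t (`|h t| `^ r)%:E)%E.
  by apply: integral_ge0 => t _; rewrite lee_fin powR_ge0.
have -> : c%:E = ((c `^ r)%:E `^ r^-1)%E.
  by rewrite poweR_EFin -powRrM mulfV ?gt_eqF// powRr1.
rewrite -poweRM ?lee_fin ?powR_ge0//.
apply: gt0_ler_poweR => //; rewrite ?invr_ge0 ?ltW// in_itv/= ?leey ?andbT ?ge0//.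
by rewrite mule_ge0 ?ge0// lee_fin powR_ge0.
Qed.

(** The last term of the recursion cannot be absorbed directly, since the norm
    of [g] may be infinite.  Iterating the recursion instead bounds [g t] by the
    geometric sum of the [2^-j A f(l^j t)]: the remainder [2^-n g(l^n t)] tends
    to 0 because [g] is bounded along the orbit of [t], with a bound allowed to
    depend on [t].  All dilates of [f] have the same norm.  For finite [p] the
    iteration is made on the p-th powers, which satisfy the same recursion by
    convexity, so that integrating the series replaces an infinite Minkowski
    inequality.  As the constant is [2 A], the case [A = 2^-1], [l = 1] is
    plain monotonicity of the norm. *)
Lemma Lnorm_absorb_dilation (p : \bar R) l A f g :
  (1 <= p)%E -> 0 < l -> 0 < A ->
  measurable_fun setT f -> measurable_fun setT g ->
  (forall t, 0 < t -> 0 <= f t) -> (forall t, 0 < t -> 0 <= g t) ->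
  (forall t, 0 < t -> g t <= A * f t + 2^-1 * g (l * t)) ->
  (forall t, 0 < t -> exists B, forall n, g (l ^+ n * t) <= B) ->
  (Lnorm haar p (EFin \o g) <= (2 * A)%:E * Lnorm haar p (EFin \o f))%E.
Proof.
move=> p1 l0 A_gt0 mf mg f0 g0 gf gB.
have A0 := ltW A_gt0.
have ln0 n : 0 < l ^+ n by rewrite exprn_gt0.
have h0 n : 0 <= 2^-1 ^+ n :> R by rewrite exprn_ge0// invr_ge0.
case: p p1 => [r||//]; last first.
  move=> _; rewrite unlock /= haarT_gt0.
  set M := ess_sup haar (abse \o (EFin \o f)).
  have M0 : (0 <= M)%E.
    apply: ess_sup_gee; [exact: haarT_gt0|].
    by apply: nearW => t /=; rewrite lee_fin.
  have [Moo|Mfin] := eqVneq M +oo%E.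
    by rewrite Moo gt0_muley ?leey// lte_fin mulr_gt0.
  have {Mfin} : M \is a fin_num by rewrite ge0_fin_numE// lt_neqAle Mfin leey.
  move=> /fineK; move: (fine M) => B MB; rewrite -MB lee_fin in M0.
  apply/ess_supP; rewrite -MB.
  have fB : {ae haar, forall t, `|f t| <= B}.
    by apply: filterS (ess_sup_ge haar (abse \o (EFin \o f))) => t /=;
      rewrite -/M -MB lee_fin.
  have fnB : {ae haar, forall t, forall n, `|f (l ^+ n * t)| <= B}.
    apply: ae_foralln => n.
    exact: (@ae_dilation R _ (fun s => `|f s| <= B)).
  apply: filterS2 (@haar_ae_pos R) fnB => t t0 ftB.
  rewrite /= -EFinM lee_fin ger0_norm; last exact: g0.
  have [B' gB'] := gB t t0.
  apply: (@le_of_geometric_error 2^-1 _ _ B' half01) => n.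
  have := @iterate_half_recursion (fun j => A * f (l ^+ j * t))
    (fun j => g (l ^+ j * t)) n.
  rewrite mul1r => /(_ _)/le_trans; apply.
    by move=> j; rewrite exprS -mulrA; apply: gf; exact: mulr_gt0.
  apply: lerD; last by rewrite ler_wpM2l.
  apply: (@le_trans _ _ (\sum_(j < n) 2^-1 ^+ j * (A * B))).
    apply: ler_sum => j _; rewrite !ler_wpM2l//.
    exact: le_trans (ler_norm _) _.
  by rewrite -mulr_suml -mulrA ler_wpM2r ?sum_half_le2// mulr_ge0.
rewrite lee_fin => r1.
have r0 : 0 < r by exact: lt_le_trans r1.
apply: Lnorm_le_of_integral => //; first by rewrite mulr_ge0.
(* [(A x + y / 2) ^ r <= a x ^ r + y ^ r / 2], by convexity at [2 A x], [y]. *)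
pose a := 2^-1 * (2 * A) `^ r.
have a0 : 0 <= a by rewrite mulr_ge0 ?invr_ge0 ?powR_ge0.
pose F n t := ((2^-1 ^+ n * a) * `|f (l ^+ n * t)| `^ r)%:E.
have F0 n t : (0 <= F n t)%E.
  by rewrite lee_fin !mulr_ge0 ?powR_ge0// exprn_ge0// invr_ge0.
have mfr : measurable_fun setT (fun t => `|f t| `^ r).
  by apply: (measurableT_comp (measurable_powR r)); exact: measurableT_comp.
have mgr : measurable_fun setT (fun t => `|g t| `^ r).
  by apply: (measurableT_comp (measurable_powR r)); exact: measurableT_comp.
have mF n : measurable_fun setT (F n).
  apply/measurable_EFinP; apply: measurable_funM => //.
  apply: (measurableT_comp mfr); exact: measurable_dilation.
apply: (@le_trans _ _ (\int[haar]_t (\sum_(n <oo) F n t))%E).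
  apply: ae_ge0_le_integral => //.
  - exact/measurable_EFinP.
  - by move=> t _; apply: nneseries_ge0 => n _ _.
  - by apply: ge0_emeasurable_sum => // n t _ _; exact: F0.
  apply: filterS (@haar_ae_pos R) => t t0 _.
  have [B' gB'] := gB t t0.
  have partial n : `|g t| `^ r <=
      \sum_(j < n) 2^-1 ^+ j * (a * `|f (l ^+ j * t)| `^ r)
      + 2^-1 ^+ n * `|B'| `^ r.
    have := @iterate_half_recursion (fun j => a * `|f (l ^+ j * t)| `^ r)
      (fun j => `|g (l ^+ j * t)| `^ r) n.
    rewrite mul1r => /(_ _)/le_trans; apply.
      move=> j; have tj : 0 < l ^+ j * t by exact: mulr_gt0.
      rewrite exprS -mulrA !ger0_norm ?f0 ?g0 ?mulr_gt0//.
      rewrite /a -mulrA -powRM ?f0 ?mulr_ge0//.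
      apply: le_trans (powR_half_convex _ _ _) => //; rewrite ?g0 ?mulr_ge0 ?mulr_gt0 ?f0//.
      apply: ge0_ler_powR; rewrite ?nnegrE ?addr_ge0 ?mulr_ge0 ?invr_ge0 ?g0 ?f0 ?mulr_gt0 ?(ltW r0)//.
      by rewrite -mulrA mulKf ?pnatr_eq0// gf.
    rewrite lerD2l ler_wpM2l// ge0_ler_powR ?nnegrE ?(ltW r0)//.
    rewrite ger0_norm ?g0 ?mulr_gt0//.
    by apply: le_trans (gB' n) _; exact: ler_norm.
  set S := (X in (_ <= X)%E).
  have SF n : (\sum_(j < n) F j t <= S)%E.
    by rewrite -(big_mkord xpredT (F ^~ t)); exact: nneseries_lim_ge.
  have S0 : (0 <= S)%E by have := SF 0; rewrite big_ord0.
  have [->|Sfin] := eqVneq S +oo%E; first exact: leey.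
  have {Sfin} : S \is a fin_num by rewrite ge0_fin_numE// lt_neqAle Sfin leey.
  move=> /fineK; move: (fine S) => s sS; rewrite -sS lee_fin.
  apply: (@le_of_geometric_error 2^-1 _ _ (`|B'| `^ r) half01) => n.
  apply: le_trans (partial n) _; rewrite lerD2r -lee_fin sS.
  apply: le_trans (SF n); rewrite /F sumEFin lee_fin.
  by apply: ler_sum => j _; rewrite mulrA.
rewrite integral_nneseries//.
have intF n : (\int[haar]_t F n t =
    (2^-1 ^+ n * a)%:E * \int[haar]_t (`|f t| `^ r)%:E)%E.
  have c0 : 0 <= 2^-1 ^+ n * a by exact: mulr_ge0.
  pose H t := ((2^-1 ^+ n * a)%:E * (`|f t| `^ r)%:E)%E.
  transitivity (\int[haar]_t H (l ^+ n * t)%R)%E; first exact: eq_integral.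
  have fr0 t : (0 <= (`|f t| `^ r)%:E)%E by rewrite lee_fin powR_ge0.
  have mfr' : measurable_fun setT (fun t => (`|f t| `^ r)%:E).
    exact/measurable_EFinP.
  rewrite (ge0_integral_dilation (f := H) (ln0 n))//.
  - by apply: ge0_integralZl_EFin => // t _.
  - exact: measurable_funeM.
  - by move=> t; exact: mule_ge0.
set I := (\int[haar]_t (`|f t| `^ r)%:E)%E in intF *.
have I0 : (0 <= I)%E by apply: integral_ge0 => t _; rewrite lee_fin powR_ge0.
apply: lime_le.
  by apply: is_cvg_nneseries => n _ _; apply: integral_ge0.
apply: nearW => n; rewrite big_mkord.
under eq_bigr do rewrite intF.
rewrite -ge0_sume_distrl; last by move=> j _; rewrite lee_fin mulr_ge0.
apply: lee_wpmul2r => //; rewrite sumEFin lee_fin -mulr_suml.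
apply: (@le_trans _ _ (2 * a)); first by rewrite ler_wpM2r ?sum_half_le2.
by rewrite /a mulrA mulfV// mul1r.
Qed.

(** The interval [[t, 2t]] has measure at least [2^-1] for dt/t, whatever [t]. *)
Lemma Lnorm_doubling_ge (p : \bar R) t m f : (1 <= p)%E -> 0 < t -> 0 <= m ->
  measurable_fun setT f -> (forall s, t <= s <= 2 * t -> m <= f s) ->
  ((m / 2)%:E <= Lnorm haar p (EFin \o f))%E.
Proof.
move=> p1 t0 m0 mf mle.
case: p p1 => [r||//]; last first.
  move=> _; rewrite unlock /= haarT_gt0.
  rewrite leNgt; apply/negP => supm.
  have [N [mN N0 sN]] := ess_sup_ge haar (abse \o (EFin \o f)).
  have : (haar `[t, (2 * t)%R] <= haar N)%E.
    apply: le_measure; rewrite ?inE// => s /=; rewrite in_itv/= => st.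
    apply: sN => /=; apply/negP; rewrite -ltNge.
    apply: lt_le_trans supm _; rewrite lee_fin.
    apply: le_trans (ler_norm _); apply: le_trans (mle s st).
    by rewrite ler_pdivrMr// ler_peMr// ler1n.
  by rewrite N0 leNgt (lt_le_trans _ (haar_doubling_ge t0))// lte_fin invr_gt0.
rewrite lee_fin => r1.
have r0 : 0 < r by exact: lt_le_trans r1.
rewrite Lnorm_EFin.
have -> : (m / 2)%:E = (((m / 2) `^ r)%:E `^ r^-1)%E.
  by rewrite poweR_EFin -powRrM mulfV ?gt_eqF// powRr1// divr_ge0.
have mfr : measurable_fun setT (fun t => (`|f t| `^ r)%:E).
  apply/measurable_EFinP; apply: (measurableT_comp (measurable_powR r)).
  exact: measurableT_comp.
have pos s : (0 <= (`|f s| `^ r)%:E)%E by rewrite lee_fin powR_ge0.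
apply: gt0_ler_poweR; rewrite ?in_itv/= ?leey ?andbT ?invr_ge0 ?(ltW r0)//.
- by rewrite lee_fin powR_ge0.
- exact: integral_ge0.
apply: (@le_trans _ _ (\int[haar]_(s in `[t, (2 * t)%R]) (cst (m `^ r)%:E s))%E).
  rewrite integral_cst//=.
  apply: (@le_trans _ _ ((m `^ r)%:E * (2^-1)%:E)%E); last first.
    by rewrite lee_wpmul2l ?haar_doubling_ge// lee_fin powR_ge0.
  rewrite -EFinM lee_fin powRM// ?invr_ge0//.
  rewrite ler_wpM2l ?powR_ge0//.
  by apply: ge1r_powR => //; rewrite invr_gt0 ltr0n invf_le1 ?ler1n.
apply: (@le_trans _ _ (\int[haar]_(s in `[t, (2 * t)%R]) (`|f s| `^ r)%:E)%E).
  apply: ge0_le_integral => //.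
  - by move=> s _; rewrite lee_fin powR_ge0.
  - exact: measurable_funTS.
  - move=> s /=; rewrite in_itv/= => /mle ms; rewrite lee_fin.
    rewrite ge0_ler_powR ?nnegrE ?(ltW r0)//.
    exact: le_trans (ler_norm _).
exact: ge0_subset_integral.
Qed.

End LnormDilation.

(** * The K-functional *)
Section KFunctional.
Context {R : realType} {k : scalar_kind}.
Context {X0 X1 : normedModType (scalars R k)} (iota : {linear X1 -> X0}).
Variable Y : set X1.
Hypothesis Y0 : Y 0.
Implicit Types (s t e : R) (u : X0).

Local Notation costs t u := [set r : R | exists (u0 : X0) (u1 : X1),
  [/\ Y u1, u = u0 + iota u1 & r = nrm u0 + t * nrm u1]].

Lemma K_functional_costs_neq0 t u : costs t u !=set0.
Proof.
by exists (nrm u), u, 0; split; rewrite ?linear0 ?nrm0 ?mulr0 ?addr0.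
Qed.

Lemma K_functional_costs_lb t u : 0 <= t -> lbound (costs t u) 0.
Proof.
by move=> t0 _ [u0 [u1 [_ _ ->]]]; rewrite addr_ge0 ?mulr_ge0 ?nrm_ge0.
Qed.

Lemma K_functional_has_inf t u : 0 <= t -> has_inf (costs t u).
Proof.
move=> t0; split; first exact: K_functional_costs_neq0.
by exists 0; exact: K_functional_costs_lb.
Qed.

Lemma K_functional_ge0 t u : 0 <= t -> 0 <= K_functional iota Y t u.
Proof.
move=> t0; apply: lb_le_inf; first exact: K_functional_costs_neq0.
exact: K_functional_costs_lb.
Qed.

Lemma K_functional_le t (u0 : X0) (u1 : X1) : 0 <= t -> Y u1 ->
  K_functional iota Y t (u0 + iota u1) <= nrm u0 + t * nrm u1.
Proof.
move=> t0 Yu1; apply: ge_inf; first by exists 0; exact: K_functional_costs_lb.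
by exists u0, u1.
Qed.

Lemma K_functional_approx t u e : 0 <= t -> 0 < e -> exists (u0 : X0) (u1 : X1),
  [/\ Y u1, u = u0 + iota u1 & nrm u0 + t * nrm u1 < K_functional iota Y t u + e].
Proof.
move=> t0 e0.
have [_ [u0 [u1 [Yu1 uE ->]]] lt_e] :=
  inf_adherent e0 (K_functional_has_inf u t0).
by exists u0, u1.
Qed.

Lemma K_functional_le_nrm t u : 0 <= t -> K_functional iota Y t u <= nrm u.
Proof.
move=> t0; have := @K_functional_le t u 0 t0 Y0.
by rewrite linear0 addr0 nrm0 mulr0 addr0.
Qed.

Lemma K_functional_homo s t u : 0 <= s -> s <= t ->
  K_functional iota Y s u <= K_functional iota Y t u.
Proof.
move=> s0 st; apply/ler_addgt0Pr => e e0.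
have t0 := le_trans s0 st.
have [u0 [u1 [Yu1 -> /ltW]]] := K_functional_approx u t0 e0.
apply: le_trans; apply: le_trans (K_functional_le _ s0 Yu1) _.
by rewrite lerD2l ler_wpM2r ?nrm_ge0.
Qed.

(** Monotonicity in [t] gives measurability on the positive half-line, but the
    weighted norm is an integral over the whole line.  For negative [t] the
    infimum has value 0 as soon as the costs are unbounded below; the set of
    [t] at which a given [c] is a lower bound is still an up-closed set, hence
    an interval, and these sets generate the superlevel sets. *)
Lemma measurable_K_functional u :
  measurable_fun [set: R] (fun t => K_functional iota Y t u).
Proof.
pose above c := [set t : R | lbound (costs t u) c].
have above_up c s t : above c s -> s <= t -> above c t.
  move=> cs st _ [u0 [u1 [Yu1 uE ->]]].
  apply: (@le_trans _ _ (nrm u0 + s * nrm u1)); first by apply: cs; exists u0, u1.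
  by rewrite lerD2l ler_wpM2r ?nrm_ge0.
have measurable_up (A : set R) :
    (forall s t, A s -> s <= t -> A t) -> measurable A.
  move=> Aup; apply: is_interval_measurable => s t As At r /andP[sr _].
  exact: Aup sr.
pose bounded_below := [set t : R | exists c, above c t].
have mb : measurable bounded_below.
  by apply: measurable_up => s t [c cs] st; exists c; exact: above_up st.
apply: (measurability (@RGenCInfty.G R)) => [|/= _ [_] [c] -> <-].
  exact: RGenCInfty.measurableE.
rewrite setTI.
have KE : (fun t => K_functional iota Y t u) @^-1` `[c, +oo[ =
    (bounded_below `&` above c) `|` (~` bounded_below `&` [set _ | c <= 0]).
  apply/seteqP; split => t /=; rewrite in_itv/= andbT.
    have [bt|nbt] := pselect (bounded_below t) => cK; last first.
      right; split => //; apply: le_trans cK _.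
      rewrite /K_functional inf_out// => -[_ [b bb]]; apply: nbt; by exists b.
    left; split => // r rt; apply: le_trans cK _; apply: ge_inf => //.
  move=> [[bt ct]|[nbt c0]].
    by apply: lb_le_inf => //; exact: K_functional_costs_neq0.
  rewrite /K_functional inf_out// => -[_ [b bb]]; apply: nbt; by exists b.
rewrite KE; apply: measurableU; apply: measurableI => //.
- by apply: measurable_up => s t; exact: above_up.
- exact: measurableC.
- have [c0|c0] := pselect (c <= 0).
    by rewrite (_ : [set _ | _] = setT)//; apply/seteqP; split.
  by rewrite (_ : [set _ | _] = set0)//; apply/seteqP; split.
Qed.

End KFunctional.

Section KFunctionalComparison.
Context {R : realType} {k : scalar_kind}.
Context {X0 X1 : normedModType (scalars R k)} (iota : {linear X1 -> X0}).
Implicit Types (s t e : R) (u v : X0).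

Lemma K_functional_subset (Y Z : set X1) t u : Y 0 -> Y `<=` Z -> 0 <= t ->
  K_functional iota Z t u <= K_functional iota Y t u.
Proof.
move=> Y0 YZ t0; apply/ler_addgt0Pr => e e0.
have [u0 [u1 [Yu1 -> /ltW]]] := K_functional_approx iota Y0 u t0 e0.
by apply: le_trans; apply: K_functional_le => //; exact: YZ.
Qed.

Lemma nrm_le_K_functional (Y : set X1) L t u : Y 0 -> 1 <= L ->
  (forall x, nrm (iota x) <= L * nrm x) -> 1 <= t ->
  nrm u <= L * K_functional iota Y t u.
Proof.
move=> Y0 L1 iotaL t1; apply/ler_addgt0Pr => e e0.
have L0 : 0 < L by exact: lt_le_trans L1.
have t0 : 0 <= t by exact: le_trans t1.
have [u0 [u1 [Yu1 uE /ltW Ke]]] :=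
  K_functional_approx iota Y0 u t0 (divr_gt0 e0 L0).
rewrite {1}uE; apply: le_trans (nrmD _ _) _.
apply: (@le_trans _ _ (L * (nrm u0 + t * nrm u1))); last first.
  have := ler_wpM2l (ltW L0) Ke.
  by rewrite (mulrDr L (K_functional _ _ _ _)) mulrCA divff ?gt_eqF// mulr1.
rewrite mulrDr lerD//; first by rewrite ler_peMl ?nrm_ge0.
apply: le_trans (iotaL _) _; rewrite ler_wpM2l ?(ltW L0)//.
by rewrite ler_peMl ?nrm_ge0.
Qed.

Lemma K_functional_linear (S : submodClosed X1) (a : scalars R k) t u v : 0 <= t ->
  let K := K_functional iota [set x | x \in S] t in
  K (a *: u + v) <= real_value `|a| * K u + K v.
Proof.
move=> t0 /=; set Y := [set x | _]; apply/ler_addgt0Pr => e e0.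
have Y0 : Y 0 by exact: rpred0.
set c := real_value `|a|; have c0 : 0 <= c by exact: real_value_norm_ge0.
have c1 : 0 < c + 1 by exact: ltr_wpDl.
have [u0 [u1 [Yu1 uE Ku]]] :=
  K_functional_approx iota Y0 u t0 (divr_gt0 e0 c1).
have [v0 [v1 [Yv1 vE Kv]]] :=
  K_functional_approx iota Y0 v t0 (divr_gt0 e0 c1).
have -> : a *: u + v = (a *: u0 + v0) + iota (a *: u1 + v1).
  by rewrite {1}uE {1}vE linearP scalerDr addrACA.
apply: le_trans (K_functional_le _ _ t0 _) _.
  by rewrite /Y/= rpredD// rpredZ.
have N0 := nrmD (a *: u0) v0; have N1 := nrmD (a *: u1) v1.
rewrite !nrmZ -/c in N0 N1.
apply: le_trans (lerD N0 (ler_wpM2l t0 N1)) _.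
have {}Ku := ler_wpM2l c0 (ltW Ku); have {}Kv := ltW Kv.
apply: (@le_trans _ _ (c * (nrm u0 + t * nrm u1) + (nrm v0 + t * nrm v1))).
  by rewrite le_eqVlt; apply/orP; left; apply/eqP; ring.
apply: le_trans (lerD Ku Kv) _; rewrite le_eqVlt; apply/orP; left; apply/eqP.
by field; rewrite gt_eqF.
Qed.

End KFunctionalComparison.

Lemma le_of_scaled_error (R : realType) (x y B : R) :
  0 <= B -> (forall e, 0 < e -> x <= y + B * e) -> x <= y.
Proof.
move=> B0 xy; apply/ler_addgt0Pr => e e0.
have B1 : 0 < B + 1 by rewrite ltr_wpDl.
apply: le_trans (xy _ (divr_gt0 e0 B1)) _; rewrite lerD2l mulrCA ler_piMr ?(ltW e0)//.
by rewrite ler_pdivrMr// mul1r lerDl.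
Qed.

Lemma K_functional_dilation (R : realType) (k : scalar_kind)
    (X0 X1 : normedModType (scalars R k)) (iota : {linear X1 -> X0})
    (Y : set X1) (l t : R) u : Y 0 -> 0 <= l -> 0 <= t ->
  K_functional iota Y (l * t) u <= (1 + l) * K_functional iota Y t u.
Proof.
move=> Y0 l0 t0; have l1 : 0 <= 1 + l by rewrite addr_ge0.
apply: (le_of_scaled_error l1) => e e0.
have [u0 [u1 [Yu1 uE ue]]] := K_functional_approx iota Y0 u t0 e0.
rewrite {1}uE; apply: le_trans (K_functional_le _ _ (mulr_ge0 l0 t0) Yu1) _.
rewrite -mulrDr; apply: le_trans (ler_wpM2l l1 (ltW ue)).
have : 0 <= l * nrm u0 by rewrite mulr_ge0 ?nrm_ge0.
have : 0 <= t * nrm u1 by rewrite mulr_ge0 ?nrm_ge0.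
lra.
Qed.

(** * The size of the K-functional of an element of the interpolation space *)

Section InterpolationPointwise.
Context {R : realType} {k : scalar_kind}.
Context {X0 X1 : normedModType (scalars R k)} (iota : {linear X1 -> X0}).
Implicit Types (theta t : R) (u : X0).

Lemma measurable_weighted_K (Y : set X1) theta u : Y 0 ->
  measurable_fun [set: R] (fun t => t `^ (- theta) * K_functional iota Y t u).
Proof.
move=> Y0; apply: measurable_funM; first exact: measurable_powR.
exact: measurable_K_functional.
Qed.

(** Being nondecreasing, the K-functional is at least its value at [t] on the
    whole interval [[t, 2t]]; hence its weighted L^p norm dominates each of its
    values, also for finite [p]. *)
Lemma K_functional_le_interp_norm (Y : set X1) theta (p : \bar R) u d t :
  Y 0 -> 0 < theta < 1 -> (1 <= p)%E -> 0 < t ->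
  (interp_norm iota Y theta p u <= d%:E)%E ->
  K_functional iota Y t u <= 4 * d * t `^ theta.
Proof.
move=> Y0 /andP[th0 th1] p1 t0 normd.
have K0 := K_functional_ge0 iota Y0 u (ltW t0).
pose m := 2^-1 * (t `^ (- theta) * K_functional iota Y t u).
have m0 : 0 <= m by rewrite !mulr_ge0 ?powR_ge0 ?invr_ge0.
have mle s : t <= s <= 2 * t -> m <= s `^ (- theta) * K_functional iota Y s u.
  move=> /andP[ts s2]; have s0 : 0 < s by exact: lt_le_trans ts.
  apply: (@le_trans _ _ (s `^ (- theta) * K_functional iota Y t u)); last first.
    by rewrite ler_wpM2l ?powR_ge0 ?K_functional_homo// ltW.
  rewrite /m mulrA ler_wpM2r// !powRN -invfM lef_pV2 ?posrE ?mulr_gt0 ?powR_gt0//.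
  apply: (@le_trans _ _ ((2 * t) `^ theta)).
    by apply: ge0_ler_powR => //; rewrite ?nnegrE ?(ltW th0)// ltW// mulr_gt0.
  rewrite powRM ?(ltW t0)// ler_wpM2r ?powR_ge0//.
  by rewrite -[leRHS]powRr1// ler_powR ?ler1n// ltW.
have := le_trans (Lnorm_doubling_ge p1 t0 m0 (measurable_weighted_K theta u Y0) mle) normd.
rewrite lee_fin -ler_pdivrMr ?powR_gt0// mulrC -powRN /m.
by rewrite (mulrC (K_functional _ _ _ _)); set z := _ `^ _ * _; lra.
Qed.

End InterpolationPointwise.

(** * The quotient norm and the order of a subspace *)

Section QuotientNorm.
Context {R : realType} {k : scalar_kind}.
Context {X0 X1 : normedModType (scalars R k)} (iota : {linear X1 -> X0}).
Variable S : submodClosed X1.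
Implicit Types (t e : R) (x y s : X1).

Local Notation q x := (quotient_norm (qproj S x)).

Lemma quotient_norm_has_inf x :
  has_inf [set r : R | exists2 y : X1, qproj S y = qproj S x & r = nrm y].
Proof.
split; first by exists (nrm x), x.
by exists 0 => _ [y _ ->]; exact: nrm_ge0.
Qed.

Lemma quotient_norm_ge0 x : 0 <= q x.
Proof.
apply: lb_le_inf; first by have [] := quotient_norm_has_inf x.
by move=> _ [y _ ->]; exact: nrm_ge0.
Qed.

Lemma quotient_norm_le x y : x - y \in S -> q x <= nrm y.
Proof.
move=> xyS; apply: ge_inf; first by have [] := quotient_norm_has_inf x.
by exists y => //; apply/esym/qproj_eq.
Qed.

Lemma quotient_norm_approx x e : 0 < e ->
  exists2 y, x - y \in S & nrm y < q x + e.
Proof.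
move=> e0; have [_ [y /esym/qproj_eq xyS ->]] :=
  inf_adherent e0 (quotient_norm_has_inf x).
by exists y.
Qed.

Lemma quotient_norm_le0 x : closed [set x | x \in S] -> q x <= 0 -> x \in S.
Proof.
move=> clS qx0; apply: (closed_nrm clS) => e e0.
have [y xyS ye] := quotient_norm_approx x e0.
exists (x - y) => //; rewrite opprB addrC subrK.
by apply: lt_le_trans ye _; rewrite gerDr.
Qed.

(** The two halves of the exact order play different roles: the first bounds a
    quotient norm by a J-functional, the second corrects an element of [X1] by
    an element of [S] so that its J-functional becomes small. *)
Lemma order_bounds (theta0 : R) : exactly_of_order iota S theta0 ->
  exists2 c : R, 1 <= c &
    (forall t x, 0 < t <= 1 -> t `^ theta0 * q x <= c * J_functional iota t x) /\
    (forall t x e, 0 < t <= 1 -> 0 < e ->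
       exists2 v, v \in S &
         J_functional iota t (x - v) <= c * (t `^ theta0 * q x) + e).
Proof.
case=> C1 [C2 [C10 C20 CJ]]; set c := 1 + C2 + C1^-1.
have C1V0 : 0 < C1^-1 by rewrite invr_gt0.
have c1 : 1 <= c by rewrite /c; lra.
have J0 t x : 0 < t -> 0 <= J_functional iota t x.
  by move=> t0; rewrite addr_ge0 ?mulr_ge0 ?nrm_ge0// ltW.
have infJ t x : 0 < t ->
    has_inf [set r : R | exists2 v, v \in S & r = J_functional iota t (x - v)].
  move=> t0; split; first by exists (J_functional iota t (x - 0)), 0; rewrite ?rpred0.
  by exists 0 => _ [v _ ->]; exact: J0.
exists c => //; split => [t x t01|t x e t01 e0].
  have [/andP[t0 _] /andP[_ qJ]] := (t01, CJ t x t01).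
  apply: le_trans qJ _.
  apply: (@le_trans _ _ (C2 * J_functional iota t x)).
    rewrite ler_wpM2l ?(ltW C20)//; apply: ge_inf.
      by have [] := infJ t x t0.
    by exists 0; rewrite ?rpred0 ?subr0.
  by rewrite ler_wpM2r ?J0// /c; lra.
have [/andP[t0 _] /andP[Jq _]] := (t01, CJ t x t01).
have [_ [v vS ->] ve] := inf_adherent e0 (infJ t x t0).
exists v => //; apply: le_trans (ltW ve) _; rewrite lerD2r.
rewrite -/(quotient_J iota S t x).
have {}Jq : quotient_J iota S t x <= C1^-1 * (t `^ theta0 * q x).
  by rewrite ler_pdivlMl.
apply: le_trans Jq _; rewrite ler_wpM2r ?mulr_ge0 ?powR_ge0 ?quotient_norm_ge0//.
by rewrite /c; lra.
Qed.

End QuotientNorm.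

(** * Comparing the two K-functionals *)

Section Recurrence.
Context {R : realType} {k : scalar_kind}.
Context {X0 X1 : normedModType (scalars R k)} (iota : {linear X1 -> X0}).
Variables (S : submodClosed X1) (theta0 L : R).
Hypothesis L1 : 1 <= L.
Hypothesis iotaL : forall x, nrm (iota x) <= L * nrm x.
Hypothesis S_order : exactly_of_order iota S theta0.
Implicit Types (theta t l : R) (u : X0).

Local Notation KT := (K_functional iota setT).
Local Notation KS := (K_functional iota [set x : X1 | x \in S]).

Let S0 : [set x : X1 | x \in S] 0. Proof. exact: rpred0. Qed.

(** Let [u = u0 + a] be nearly optimal for the couple [(X0, X1)] at [t], and
    [u = w + s] nearly optimal for [(X0, S)] at [l t].  As [a - s = w - u0] in
    [X0], the J-functional of [a - s] at [l t] is small, so the first half of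
    the order bounds the quotient norm of [a].  The second half then gives [v]
    in [S] with [a - v] small at [t], and [u = (u0 + (a - v)) + v] is the wanted
    decomposition.  The order is only known on ]0, 1]; beyond 1 both
    K-functionals are comparable to the norm of [X0].

    The point is that [c] does not depend on [l]: since it is multiplied by a
    power of [l] that becomes [l ^ (theta - theta0)] after weighting, it is made
    small by taking [l] small above [theta0] and [l] large below. *)
Lemma K_recurrence : exists2 c : R, 1 <= c & forall l, 0 < l ->
  exists2 A, 0 < A & forall t u, 0 < t ->
    KS t u <= A * KT t u + c * l `^ (- theta0) * KS (l * t) u.
Proof.
have [c c1 [qJ Jq]] := order_bounds S_order.
have c0 : 0 < c by exact: lt_le_trans c1.
have L0 : 0 < L by exact: lt_le_trans L1.
exists (c ^+ 2) => [|l l0]; first by rewrite exprn_ege1.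
set b := c ^+ 2 * l `^ (- theta0).
have b0 : 0 <= b by rewrite mulr_ge0 ?powR_ge0 ?exprn_ge0 ?ltW.
exists (1 + b * (1 + l) + L * (1 + l)).
  have : 0 <= b * (1 + l) by rewrite mulr_ge0// addr_ge0// ltW.
  have : 0 <= L * (1 + l) by rewrite mulr_ge0 ?addr_ge0// ltW.
  lra.
move=> t u t0.
have lt0 : 0 < l * t by exact: mulr_gt0.
have KT0 : 0 <= KT t u by rewrite K_functional_ge0 ?ltW.
have KSl0 : 0 <= KS (l * t) u by rewrite K_functional_ge0 ?ltW.
have bKS : 0 <= b * KS (l * t) u by exact: mulr_ge0.
have l1 : 0 <= 1 + l by rewrite addr_ge0// ltW.
have bKT : 0 <= b * (1 + l) * KT t u by apply: mulr_ge0 => //; exact: mulr_ge0.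
have LKT : 0 <= L * KT t u by apply: mulr_ge0 => //; exact: ltW.
have LlKT : 0 <= l * (L * KT t u) by apply: mulr_ge0 => //; exact: ltW.
have [t1|t1] := ltP 1 t.
  apply: le_trans (K_functional_le_nrm iota S0 u (ltW t0)) _.
  have := nrm_le_K_functional u (I : setT (0 : X1)) L1 iotaL (ltW t1); lra.
have [lt1|lt1] := ltP 1 (l * t).
  apply: le_trans (K_functional_le_nrm iota S0 u (ltW t0)) _.
  have := nrm_le_K_functional u (I : setT (0 : X1)) L1 iotaL (ltW lt1).
  have := K_functional_dilation iota u (I : setT (0 : X1)) (ltW l0) (ltW t0).
  by move=> /(ler_wpM2l (ltW L0)); lra.
suff : KS t u <= KT t u + b * (KS (l * t) u + (1 + l) * KT t u) by lra.
apply: (@le_of_scaled_error _ _ _ (2 + b * (2 + l))).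
  by rewrite addr_ge0// mulr_ge0// addr_ge0// ltW.
move=> e e0.
have [u0 [a [_ uE ua]]] := K_functional_approx iota (I : setT (0 : X1)) u (ltW t0) e0.
have [w [s [sS uE' us]]] := K_functional_approx iota S0 u (ltW lt0) e0.
have ias : iota (a - s) = w - u0.
  have e2 : u0 + iota a = w + iota s by rewrite -uE.
  have -> : w = u0 + iota a - iota s by rewrite e2 addrK.
  by rewrite linearB [RHS]addrC !addrA addNr add0r.
have /= := qJ (l * t) (a - s); rewrite lt0 lt1 => /(_ isT) qas.
have Jas : J_functional iota (l * t) (a - s) <=
    KS (l * t) u + (1 + l) * KT t u + (2 + l) * e.
  rewrite /J_functional ias.
  have H1 := nrmB w u0; have H2 := ler_wpM2l (ltW lt0) (nrmB a s).
  have H3 : nrm u0 + l * t * nrm a <= (1 + l) * (KT t u + e).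
    apply: le_trans (ler_wpM2l _ (ltW ua)); last by rewrite addr_ge0// ltW.
    have : 0 <= l * nrm u0 by rewrite mulr_ge0 ?nrm_ge0// ltW.
    have : 0 <= t * nrm a by rewrite mulr_ge0 ?nrm_ge0// ltW.
    lra.
  lra.
have qa : t `^ theta0 * quotient_norm (qproj S a) <=
    c * l `^ (- theta0) * (KS (l * t) u + (1 + l) * KT t u + (2 + l) * e).
  have qE : qproj S a = qproj S (a - s).
    by apply/qproj_eq; rewrite opprB addrC subrK.
  have lth : 0 < l `^ theta0 by rewrite powR_gt0.
  rewrite qE powRN mulrAC ler_pdivlMr// mulrAC.
  have := ler_wpM2l (ltW c0) Jas; move/(le_trans qas).
  by rewrite (powRM _ (ltW l0) (ltW t0)) (mulrC (l `^ _)).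
have /= := Jq t a e; rewrite t0 t1 => /(_ isT e0)[v vS Jv].
have uv : u = (u0 + iota (a - v)) + iota v.
  by rewrite -addrA -linearD subrK.
rewrite {1}uv; apply: le_trans (K_functional_le _ _ (ltW t0) vS) _.
have H1 := nrmD u0 (iota (a - v)).
have H2 : nrm v <= nrm a + nrm (a - v).
  by have := nrmB a (a - v); rewrite opprB addrC subrK.
have {}H2 := ler_wpM2l (ltW t0) H2.
have H3 := ler_wpM2l (ltW c0) qa.
have bE : b = c * (c * l `^ (- theta0)) by rewrite /b expr2 mulrA.
rewrite (mulrA c (c * _)) -bE in H3.
rewrite /J_functional in Jv.
lra.
Qed.

(** Above [theta0] the recurrence runs towards 0, where the weighted K-functional
    has to be assumed bounded: this is the place where the kernel of the trace
    enters.  Below [theta0] it runs towards infinity, where the bound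
    [KS t u <= nrm u] suffices. *)
Lemma interp_norm_subspace_le theta p : 0 < theta0 < 1 -> 0 < theta < 1 ->
  theta != theta0 -> (1 <= p)%E ->
  exists2 C, 0 < C & forall u,
    (theta0 < theta -> exists M, forall t, 0 < t <= 1 -> KS t u <= M * t `^ theta) ->
    (interp_norm iota [set x : X1 | x \in S] theta p u <=
       C%:E * interp_norm iota setT theta p u)%E.
Proof.
move=> /andP[th00 th01] /andP[th0 th1] thN p1.
have [c c1 rec] := K_recurrence.
have c0 : 0 < c by exact: lt_le_trans c1.
(* This dilation turns the constant of the weighted recurrence into 1/2. *)
pose l := (2 * c) `^ (- (theta - theta0)^-1).
have l0 : 0 < l by rewrite powR_gt0// mulr_gt0.
have [A A0 {}rec] := rec l l0.
have d0 : theta - theta0 != 0 by rewrite subr_eq0.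
have ltheta : c * l `^ (- theta0) = 2^-1 * l `^ (- theta).
  have -> : - theta0 = - theta + (theta - theta0) by ring.
  rewrite powRD; last by apply/implyP => _; rewrite gt_eqF.
  rewrite {2}/l -powRrM mulNr mulVf// powR_inv1 ?mulr_ge0 ?(ltW c0)//.
  by field; rewrite gt_eqF.
exists (2 * A) => [|u Ku]; first by rewrite mulr_gt0.
rewrite /interp_norm.
have g0 t : 0 < t -> 0 <= t `^ (- theta) * KS t u.
  by move=> t0; rewrite mulr_ge0 ?powR_ge0 ?K_functional_ge0 ?ltW.
apply: (@Lnorm_absorb_dilation R p l A) => //.
- exact: measurable_weighted_K.
- exact: measurable_weighted_K.
- by move=> t t0; rewrite mulr_ge0 ?powR_ge0 ?K_functional_ge0 ?ltW.
- move=> t t0; have := ler_wpM2l (powR_ge0 t (- theta)) (rec t u t0).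
  by rewrite ltheta (powRM _ (ltW l0) (ltW t0)); lra.
move=> t t0.
have nrm_bound s : 0 < s -> s `^ (- theta) * KS s u <= s `^ (- theta) * nrm u.
  by move=> s0; rewrite ler_wpM2l ?powR_ge0 ?K_functional_le_nrm ?ltW.
have decr s1 s2 : 0 < s1 -> s1 <= s2 -> s2 `^ (- theta) <= s1 `^ (- theta).
  move=> s10 s12; have s20 := lt_le_trans s10 s12.
  rewrite !powRN lef_pV2 ?posrE ?powR_gt0//.
  by apply: ge0_ler_powR; rewrite ?nnegrE ?(ltW s10) ?(ltW s20) ?(ltW th0).
have [lt|gt|/eqP] := ltgtP theta theta0; last by rewrite (negbTE thN).
  exists (t `^ (- theta) * nrm u) => n.
  have l1 : 1 <= l.
    rewrite -[leLHS](powRr0 (2 * c)) ler_powR//; first lra.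
    by rewrite oppr_ge0 invr_le0 subr_le0 ltW.
  have tn : t <= l ^+ n * t by rewrite ler_peMl ?(ltW t0)// exprn_ege1.
  apply: le_trans (nrm_bound _ (lt_le_trans t0 tn)) _.
  by rewrite ler_wpM2r ?nrm_ge0// decr.
have [M KM] := Ku gt.
exists (`|M| + nrm u) => n; set s := l ^+ n * t.
have s0 : 0 < s by rewrite mulr_gt0// exprn_gt0.
have [s1|s1] := leP s 1.
  rewrite powRN mulrC ler_pdivrMr ?powR_gt0//.
  have := KM s; rewrite s0 s1 => /(_ isT)/le_trans; apply.
  rewrite ler_wpM2r ?powR_ge0//; apply: le_trans (ler_norm _) _.
  by rewrite lerDl nrm_ge0.
apply: le_trans (nrm_bound s s0) _.
apply: (@le_trans _ _ (1 * nrm u)); last by rewrite mul1r lerDr.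
rewrite ler_wpM2r ?nrm_ge0//.
by have := decr 1 s ltr01 (ltW s1); rewrite powR1.
Qed.

End Recurrence.

(** * Approximation of interpolated elements by elements of X1 *)
Section TraceConstruction.
Context {R : realType} {k : scalar_kind}.
Context {X0 : normedModType (scalars R k)} {X1 : completeNormedModType (scalars R k)}.
Variables (iota : {linear X1 -> X0}) (S : submodClosed X1) (theta0 : R).
Hypothesis S_order : exactly_of_order iota S theta0.
Hypothesis theta0_itv : 0 < theta0 < 1.
Implicit Types (theta t M : R) (u : X0) (x : X1).

Local Notation KT := (K_functional iota setT).
Local Notation KS := (K_functional iota [set x : X1 | x \in S]).

Let S0 : [set x : X1 | x \in S] 0. Proof. exact: rpred0. Qed.

Lemma powR_half_exprn n theta : (2^-1 ^+ n) `^ theta = (2^-1 `^ theta) ^+ n :> R.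
Proof.
have h0 : 0 <= (2^-1 : R) by rewrite invr_ge0.
by rewrite -(powR_mulrn n h0) -(powR_mulrn n (powR_ge0 _ theta)) -!powRrM mulrC.
Qed.

Lemma dyadic_below t : 0 < t <= 1 -> exists n : nat, t <= 2^-1 ^+ n <= 2 * t.
Proof.
move=> /andP[t0 t1].
have [m mt] : exists m : nat, 2^-1 ^+ m < t.
  have : (fun n => 2^-1 ^+ n : R) @ \oo --> (0 : R).
    apply: cvg_expr; have /andP[h0 h1] := @half01 R; by rewrite ger0_norm.
  move=> /cvgrPdist_lt/(_ t t0)[n _ /(_ n (leqnn n))] /=.
  rewrite sub0r normrN ger0_norm ?exprn_ge0 ?invr_ge0// => nt.
  by exists n.
case: (@ex_minnP (fun m => 2^-1 ^+ m < t)); first by exists m.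
move=> [|n]; first by rewrite expr0 ltNge t1.
move=> nt min_n; exists n; apply/andP; split.
  by rewrite leNgt; apply/negP => /min_n; rewrite ltnn.
by move: nt; rewrite exprS; lra.
Qed.

Lemma powR_gap theta : theta0 < theta -> 0 <= (2^-1 : R) `^ (theta - theta0) < 1.
Proof.
move=> lt; rewrite powR_ge0/=; have /andP[h0 h1] := @half01 R.
have one : 1 = 1 `^ (theta - theta0) :> R by rewrite powR1.
by rewrite [ltRHS]one; apply: gt0_ltr_powR; rewrite ?nnegrE ?subr_gt0.
Qed.

(** Let [a_n] in [X1] be nearly optimal for [u] at [2^-n].  Two successive ones
    differ by an element whose J-functional at [2^-n] is of size [2^(-n theta)],
    so that their classes modulo [S] differ by [2^(-n (theta - theta0))]: the
    classes form a Cauchy sequence.  Its limit is realised inside [X1], which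
    avoids completeness of the quotient: replacing the increments by short
    representatives [r_n] of their classes gives a convergent series with limit
    [x].  The class of [a_n - x] is then of size [2^(-n (theta - theta0))], and
    correcting [a_n - x] by an element of [S] at scale [2^-n] decomposes
    [u - x] along [X0 + S]. *)
Lemma K_functional_lift theta : theta0 < theta < 1 -> exists2 C, 0 < C &
  forall u M, 0 < M -> (forall t, 0 < t <= 1 -> KT t u <= M * t `^ theta) ->
  exists2 x, nrm x <= C * M &
    forall t, 0 < t <= 1 -> KS t (u - iota x) <= C * M * t `^ theta.
Proof.
move=> /andP[th th1]; have /andP[th00 th01] := theta0_itv.
have th0 : 0 < theta by exact: lt_trans th.
have [c c1 [qJ Jq]] := order_bounds S_order.
have c0 : 0 < c by exact: lt_le_trans c1.
set rho := (2^-1 `^ (theta - theta0) : R).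
have rho01 : 0 <= rho < 1 by exact: powR_gap.
have /andP[rho0 rho1] := rho01.
pose tau n : R := 2^-1 ^+ n.
have tau0 n : 0 < tau n by rewrite exprn_gt0// invr_gt0.
have tau1 n : tau n <= 1.
  by rewrite exprn_ile1 ?invr_ge0// invf_le1 ?ler1n.
have tau01 n : 0 < tau n <= 1 by rewrite tau0 tau1.
have tauS n : tau n.+1 = 2^-1 * tau n by rewrite /tau exprS.
have tau_rho n : tau n `^ theta = tau n `^ theta0 * rho ^+ n.
  rewrite -powR_half_exprn -/(tau n) -powRD ?subrKC//.
  by apply/implyP => _; rewrite gt_eqF.
(* [D M rho^n] bounds the tail of the series of the [r_n]; [C] is the constant
   at dyadic scales, and passing to all [t] costs a factor 2. *)
pose D := 9 * c / (1 - rho).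
have D0 : 0 <= D by rewrite divr_ge0 ?mulr_ge0 ?subr_ge0// ltW.
pose C := 5 + D + c * D.
have cD0 : 0 <= c * D by rewrite mulr_ge0// ltW.
exists (2 * C) => [|u M M0 KM]; first by rewrite mulr_gt0// /C; lra.
have tauth n : 0 < tau n `^ theta by rewrite powR_gt0.
have /choice[a aP] n : exists a : X1,
    nrm (u - iota a) + tau n * nrm a <= 2 * M * tau n `^ theta.
  have e0 : 0 < M * tau n `^ theta by rewrite mulr_gt0.
  have [u0 [u1 [_ uE ue]]] :=
    K_functional_approx iota (I : setT (0 : X1)) u (ltW (tau0 n)) e0.
  exists u1; have -> : u - iota u1 = u0 by rewrite uE addrK.
  by have := KM _ (tau01 n); lra.
have tau_le n : tau n.+1 <= tau n by rewrite tauS; have := tau0 n; lra.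
have tauM n : tau n.+1 `^ theta <= tau n `^ theta.
  by apply: ge0_ler_powR; rewrite ?nnegrE ?(ltW th0) ?(ltW (tau0 _)).
have qw n : quotient_norm (qproj S (a n.+1 - a n)) <= 8 * c * M * rho ^+ n.
  have Jw : J_functional iota (tau n.+1) (a n.+1 - a n) <= 4 * M * tau n `^ theta.
    rewrite /J_functional.
    have -> : iota (a n.+1 - a n) = (u - iota (a n)) - (u - iota (a n.+1)).
      by rewrite linearB opprB [RHS]addrC addrA subrK.
    have H1 := nrmB (u - iota (a n)) (u - iota (a n.+1)).
    have H2 := ler_wpM2l (ltW (tau0 n.+1)) (nrmB (a n.+1) (a n)).
    have H3 := aP n; have H4 := aP n.+1; have H5 := ler_wpM2l (ltW M0) (tauM n).
    have H6 : tau n.+1 * nrm (a n) <= tau n * nrm (a n).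
      by rewrite ler_wpM2r ?nrm_ge0.
    by lra.
  have := qJ _ (a n.+1 - a n) (tau01 n.+1).
  set Q := quotient_norm _ => H.
  have Q0 : 0 <= Q by exact: quotient_norm_ge0.
  have {}H := le_trans H (ler_wpM2l (ltW c0) Jw).
  have tt0 : 0 < tau n `^ theta0 by rewrite powR_gt0.
  have half_le : 2^-1 * tau n `^ theta0 <= tau n.+1 `^ theta0.
    rewrite tauS powRM ?invr_ge0 ?(ltW (tau0 n))// ler_wpM2r ?(ltW tt0)//.
    by apply: ger1_powR; rewrite ?(ltW th01)// invr_gt0 ltr0n invf_le1 ?ler1n.
  rewrite -(ler_pM2l tt0).
  have := ler_wpM2r Q0 half_le.
  by move: H; rewrite tau_rho; lra.
have /choice[r rP] n : exists r : X1,
    a n.+1 - a n - r \in S /\ nrm r <= 9 * c * M * rho ^+ n.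
  have rn0 : 0 < rho ^+ n by rewrite exprn_gt0// powR_gt0// invr_gt0.
  have e0 : 0 < c * M * rho ^+ n by rewrite !mulr_gt0.
  have [y yS yq] := quotient_norm_approx S (a n.+1 - a n) e0.
  by exists y; split => //; have := qw n; lra.
pose x_ n := a 0%N + \sum_(i < n) r i.
have x_S n : x_ n.+1 - x_ n = r n.
  by rewrite /x_ big_ord_recr/= addrA [LHS]addrC addKr.
have ax_S n : a n - x_ n \in S.
  elim: n => [|n IHn]; first by rewrite /x_ big_ord0 addr0 subrr rpred0.
  have -> : a n.+1 - x_ n.+1 = (a n - x_ n) + (a n.+1 - a n - r n).
    have -> : x_ n.+1 = x_ n + r n by rewrite -x_S addrC subrK.
    rewrite opprD addrA [RHS]addrA; congr (_ - _).
    by rewrite [RHS]addrC addrA subrK.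
  by rewrite rpredD//; have [] := rP n.
have cM0 : 0 <= 9 * c * M by rewrite !mulr_ge0// ltW.
have x_step n : nrm (x_ n.+1 - x_ n) <= 9 * c * M * rho ^+ n.
  by rewrite x_S; have [] := rP n.
have [x xP] := geometric_cvg_nrm cM0 rho01 x_step.
have {}xP n : nrm (x - x_ n) <= D * M * rho ^+ n.
  by rewrite /D (mulrAC (9 * c)).
have nx : nrm x <= (D + 2) * M.
  have := xP 0%N; rewrite /x_ big_ord0 addr0 expr0 mulr1 => H1.
  have := aP 0%N; rewrite /tau expr0 powR1 mul1r mulr1 => H2.
  have := nrmD (x - a 0%N) (a 0%N); rewrite subrK.
  have := nrm_ge0 (u - iota (a 0%N)); lra.
exists x.
  apply: le_trans nx _; rewrite ler_wpM2r ?(ltW M0)// /C; lra.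
have Ktau n : KS (tau n) (u - iota x) <= C * M * tau n `^ theta.
  set b := a n - x.
  have qb : quotient_norm (qproj S b) <= D * M * rho ^+ n.
    apply: le_trans (xP n); rewrite nrm_distC; apply: quotient_norm_le.
    by rewrite /b opprB addrA subrK.
  have e0 : 0 < M * tau n `^ theta by rewrite mulr_gt0.
  have [v vS Jv] := Jq _ b _ (tau01 n) e0.
  have uE : u - iota x = (u - iota (a n) + iota (b - v)) + iota v.
    rewrite -addrA -linearD subrK /b linearB addrA subrK//.
  rewrite uE; apply: le_trans (K_functional_le _ _ (ltW (tau0 n)) vS) _.
  have H1 := nrmD (u - iota (a n)) (iota (b - v)).
  have H2 : nrm v <= nrm (a n) + nrm x + nrm (b - v).
    have vb : v = b - (b - v) by rewrite opprB [RHS]addrC subrK.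
    have := nrmB b (b - v); rewrite -vb; have := nrmB (a n) x; rewrite -/b; lra.
  have {}H2 := ler_wpM2l (ltW (tau0 n)) H2.
  have H3 := aP n.
  have H4 : tau n * nrm x <= (D + 2) * M * tau n `^ theta.
    rewrite mulrC; apply: ler_pM => //; rewrite ?nrm_ge0 ?(ltW (tau0 n))//.
    by apply: ger1_powR => //; rewrite ltW.
  have H5 : c * (tau n `^ theta0 * quotient_norm (qproj S b)) <= c * D * M * tau n `^ theta.
    have := ler_wpM2l (powR_ge0 (tau n) theta0) qb => /(ler_wpM2l (ltW c0)).
    by rewrite tau_rho; lra.
  rewrite /J_functional in Jv; rewrite /C; lra.
move=> t t01; have [n /andP[tn nt]] := dyadic_below t01.
have /andP[t0 _] := t01.
apply: le_trans (K_functional_homo iota S0 _ (ltW t0) tn) _.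
apply: le_trans (Ktau n) _.
have C0 : 0 <= C by rewrite /C; lra.
rewrite -mulrA [2 * C]mulrC -!mulrA ler_wpM2l// mulrCA ler_wpM2l ?(ltW M0)//.
apply: (@le_trans _ _ ((2 * t) `^ theta)).
  by apply: ge0_ler_powR; rewrite ?nnegrE ?(ltW th0) ?(ltW (tau0 _)) ?mulr_ge0 ?(ltW t0).
rewrite powRM ?(ltW t0)// ler_wpM2r ?powR_ge0//.
by rewrite -[leRHS]powRr1// ler_powR ?ler1n// ltW.
Qed.

(** Elements of [X1] outside [S] have quotient J norm of order exactly [theta0],
    which excludes a K-functional of higher order. *)
Lemma K_functional_order_gt (clS : closed [set x : X1 | x \in S]) theta M x :
  theta0 < theta < 1 -> (forall t, 0 < t <= 1 -> KS t (iota x) <= M * t `^ theta) ->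
  x \in S.
Proof.
move=> /andP[th th1] KM; apply: (quotient_norm_le0 clS).
have [c c1 [qJ _]] := order_bounds S_order.
have c0 : 0 < c by exact: lt_le_trans c1.
apply: (@le_of_geometric_error R _ _ _ (c * (M + 1 + nrm x)) (powR_gap th)) => n.
pose t : R := 2^-1 ^+ n.
have t0 : 0 < t by rewrite exprn_gt0// invr_gt0.
have t1 : t <= 1 by rewrite exprn_ile1 ?invr_ge0// invf_le1 ?ler1n.
have t01 : 0 < t <= 1 by rewrite t0.
have tth : 0 < t `^ theta by rewrite powR_gt0.
have [w [s [sS xE ws]]] := K_functional_approx iota S0 (iota x) (ltW t0) tth.
have iw : iota (x - s) = w by rewrite linearB xE addrK.
have qE : qproj S x = qproj S (x - s).
  by apply/qproj_eq; rewrite opprB addrC subrK.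
have := qJ t (x - s) t01; rewrite -qE /J_functional iw.
set Q := quotient_norm _ => H.
have H1 := ler_wpM2l (ltW t0) (nrmB x s).
have H2 := KM t t01.
have H3 : t * nrm x <= t `^ theta * nrm x.
  by rewrite ler_wpM2r ?nrm_ge0//; apply: ger1_powR => //; rewrite ltW.
have H4 : c * (nrm w + t * nrm (x - s)) <= c * ((M + 1 + nrm x) * t `^ theta).
  by rewrite ler_wpM2l ?(ltW c0)//; lra.
have {}H4 := le_trans H H4.
have tE : t `^ theta = t `^ theta0 * (2^-1 `^ (theta - theta0)) ^+ n.
  rewrite -powR_half_exprn -/t -powRD ?subrKC//.
  by apply/implyP => _; rewrite gt_eqF.
by rewrite tE in H4; rewrite -(@ler_pM2l _ (t `^ theta0)) ?powR_gt0// add0r; lra.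
Qed.

End TraceConstruction.

(** * The trace and the interpolation spaces *)
Section Trace.
Context {R : realType} {k : scalar_kind}.
Context {X0 : normedModType (scalars R k)} {X1 : completeNormedModType (scalars R k)}.
Variables (iota : {linear X1 -> X0}) (S : submodClosed X1) (theta0 : R).
Hypothesis S_order : exactly_of_order iota S theta0.
Hypothesis theta0_itv : 0 < theta0 < 1.
Hypothesis S_closed : closed [set x : X1 | x \in S].
Implicit Types (theta t M : R) (u v : X0) (x : X1).

Local Notation KT := (K_functional iota setT).
Local Notation KS := (K_functional iota [set x : X1 | x \in S]).

Let S0 : [set x : X1 | x \in S] 0. Proof. exact: rpred0. Qed.

(** The union over [theta > theta0] of the spaces [[X0, S]_(theta, oo)]; a union
    rather than one of them, so that the trace below does not depend on [theta]. *)
Definition of_higher_order u := exists theta M,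
  theta0 < theta < 1 /\ forall t, 0 < t <= 1 -> KS t u <= M * t `^ theta.

Definition trace_rel u (z : quotient_space S) :=
  exists2 x, qproj S x = z & of_higher_order (u - iota x).

(** The extension of the projection.  No limit is taken: the class of [x] is the
    trace of [u] as soon as [u - x] is of higher order than [theta0].  The
    default value is only used outside all the spaces [[X0, X1]_(theta, p)] with
    [theta > theta0]. *)
Definition trace u : quotient_space S := xget 0 (trace_rel u).

Lemma qproj0 : qproj S 0 = 0.
Proof. by apply: (addIr (qproj S 0)); rewrite -qprojD !add0r. Qed.

Lemma qprojZ a x : qproj S (a *: x) = a *: qproj S x.
Proof. by rewrite -quotient_scaleE. Qed.

Lemma of_higher_order0 : of_higher_order 0.
Proof.
have /andP[th0 th1] := theta0_itv.
exists ((theta0 + 1) / 2), 0; split; first by apply/andP; split; lra.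
move=> t /andP[t0 _]; rewrite mul0r.
by apply: le_trans (K_functional_le_nrm iota S0 0 (ltW t0)) _; rewrite nrm0.
Qed.

Lemma of_higher_order_linear (a : scalars R k) u v :
  of_higher_order u -> of_higher_order v -> of_higher_order (a *: u + v).
Proof.
move=> [th [M [/andP[th0 th1] uM]]] [th' [M' [/andP[th'0 th'1] vM]]].
exists (Num.min th th'), (real_value `|a| * `|M| + `|M'|); split.
  by rewrite lt_min th0 th'0/= gt_min th1.
move=> t /[dup] t01 /andP[t0 t1].
apply: le_trans (K_functional_linear iota S a u v (ltW t0)) _.
rewrite mulrDl -mulrA; apply: lerD.
  apply: ler_wpM2l; first exact: real_value_norm_ge0.
  apply: le_trans (uM t t01) _.
  apply: (@le_trans _ _ (`|M| * t `^ th)).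
    by rewrite ler_wpM2r ?powR_ge0// ler_norm.
  by rewrite ler_wpM2l//; apply: ger_powR; rewrite ?t0// ge_min lexx.
apply: le_trans (vM t t01) _.
apply: (@le_trans _ _ (`|M'| * t `^ th')).
  by rewrite ler_wpM2r ?powR_ge0// ler_norm.
by rewrite ler_wpM2l//; apply: ger_powR; rewrite ?t0// ge_min lexx orbT.
Qed.

Lemma of_higher_order_iota x : of_higher_order (iota x) -> x \in S.
Proof. by move=> [th [M [th01 xM]]]; exact: K_functional_order_gt th01 xM. Qed.

(** If [u - x] and [u - y] are of higher order, so is [x - y], which is in [X1]
    and hence in [S]. *)
Lemma trace_rel_unique u z w : trace_rel u z -> trace_rel u w -> z = w.
Proof.
move=> [x <- ux] [y <- uy]; apply/qproj_eq; apply: of_higher_order_iota.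
have -> : iota (x - y) = -1 *: (u - iota x) + (u - iota y).
  by rewrite scaleN1r opprB linearB addrA subrK.
exact: of_higher_order_linear.
Qed.

Lemma trace_relE u z : trace_rel u z -> trace u = z.
Proof.
move=> uz; apply: (@trace_rel_unique u) (uz).
by apply: (@xgetPex _ 0 (trace_rel u)); exists z.
Qed.

Lemma trace_rel_linear (a : scalars R k) u v z w :
  trace_rel u z -> trace_rel v w -> trace_rel (a *: u + v) (a *: z + w).
Proof.
move=> [x <- ux] [y <- vy]; exists (a *: x + y); first by rewrite qprojD qprojZ.
have -> : a *: u + v - iota (a *: x + y) = a *: (u - iota x) + (v - iota y).
  by rewrite linearP scalerBr opprD addrACA.
exact: of_higher_order_linear.
Qed.

Lemma trace_iota x : trace (iota x) = qproj S x.
Proof.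
by apply: trace_relE; exists x => //; rewrite subrr; exact: of_higher_order0.
Qed.

Lemma interp_spaceP (Y : set X1) theta (p : \bar R) u : Y 0 ->
    0 < theta < 1 -> (1 <= p)%E -> interp_space iota Y theta p u ->
  exists2 M, 0 < M &
    forall t, 0 < t -> K_functional iota Y t u <= M * t `^ theta.
Proof.
move=> Y0 th p1; rewrite /interp_space/= => u_fin.
have norm_fin : interp_norm iota Y theta p u \is a fin_num.
  by rewrite ge0_fin_numE// /interp_norm Lnorm_ge0.
set d := fine (interp_norm iota Y theta p u).
exists (4 * `|d| + 1) => [|t t0]; first by have := normr_ge0 d; lra.
have := @K_functional_le_interp_norm _ _ _ _ iota Y theta p u `|d| t Y0 th p1 t0.
have -> : (interp_norm iota Y theta p u <= `|d|%:E)%E.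
  by rewrite -(fineK norm_fin) lee_fin ler_norm.
move=> /(_ isT)/le_trans; apply; rewrite ler_wpM2r ?powR_ge0// lerDl.
exact: ler01.
Qed.

Lemma trace_rel_exists theta (p : \bar R) u : theta0 < theta < 1 -> (1 <= p)%E ->
  interp_space iota setT theta p u ->
  exists2 x, qproj S x = trace u &
    exists M, forall t, 0 < t <= 1 -> KS t (u - iota x) <= M * t `^ theta.
Proof.
move=> th01 p1 Eu; have /andP[th th1] := th01; have /andP[th00 _] := theta0_itv.
have th01' : 0 < theta < 1 by rewrite th1 (lt_trans th00).
have [M M0 uM] := interp_spaceP (I : setT (0 : X1)) th01' p1 Eu.
have [C C0 lift] := K_functional_lift S_order theta0_itv th01.
have [|x _ xM] := lift u M M0; first by move=> t /andP[t0 _]; exact: uM.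
exists x; last by exists (C * M).
by apply/esym/trace_relE; exists x => //; exists theta, (C * M).
Qed.

Lemma trace_continuous_linear_extension theta (p : \bar R) :
  theta0 < theta < 1 -> (1 <= p)%E ->
  continuous_linear_extension iota theta p trace.
Proof.
move=> th01 p1; have /andP[th th1] := th01; have /andP[th00 _] := theta0_itv.
have th01' : 0 < theta < 1 by rewrite th1 (lt_trans th00).
have trace_relP u : interp_space iota setT theta p u -> trace_rel u (trace u).
  move=> /(trace_rel_exists th01 p1)[x xu [M xM]].
  by exists x => //; exists theta, M.
split; first exact: trace_iota.
  move=> a u v Eu Ev; apply: trace_relE.
  by apply: trace_rel_linear; exact: trace_relP.
move=> u Eu e e0.
have [C C0 lift] := K_functional_lift S_order theta0_itv th01.
(* The trace of [w] has norm at most [4 C] times the norm of [w]. *)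
have d0 : 0 < e / (8 * C) by rewrite divr_gt0// mulr_gt0.
exists (e / (8 * C)) => // v Ev vu.
have M0 : 0 < 4 * (e / (8 * C)) by rewrite mulr_gt0.
have [|x xM xK] := lift (v - u) _ M0.
  move=> t /andP[t0 _].
  exact: (K_functional_le_interp_norm (I : setT (0 : X1)) th01' p1 t0 (ltW vu)).
have <- : qproj S x = trace v - trace u.
  have : trace_rel (v - u) (qproj S x).
    by exists x => //; exists theta; eexists; split; [exact: th01|exact: xK].
  move=> /trace_rel_unique; apply.
  have := trace_rel_linear (-1) (trace_relP u Eu) (trace_relP v Ev).
  by rewrite !scaleN1r ![- _ + _]addrC.
apply: (@le_lt_trans _ _ (nrm x)).
  by apply: quotient_norm_le; rewrite subrr rpred0.
apply: le_lt_trans xM _.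
rewrite (_ : C * _ = e / 2); last by field; rewrite gt_eqF.
by rewrite ltr_pdivrMr// ltr_pMr// ltr1n.
Qed.

Lemma interp_norm_subset (Y Z : set X1) theta (p : \bar R) u : Y 0 -> Y `<=` Z ->
  (1 <= p)%E ->
  (interp_norm iota Z theta p u <= interp_norm iota Y theta p u)%E.
Proof.
move=> Y0 YZ p1; have Z0 : Z 0 by exact: YZ.
rewrite -[leRHS]mul1e (_ : 1%E = (2 * 2^-1)%:E); last by rewrite mulfV.
have pos (W : set X1) t : W 0 -> 0 < t ->
    0 <= t `^ (- theta) * K_functional iota W t u.
  by move=> W0 t0; rewrite mulr_ge0 ?powR_ge0 ?K_functional_ge0 ?ltW.
apply: (@Lnorm_absorb_dilation R p 1) => //.
- exact: measurable_weighted_K.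
- exact: measurable_weighted_K.
- by move=> t; exact: pos.
- by move=> t; exact: pos.
- move=> t t0; rewrite mul1r.
  suff : t `^ (- theta) * K_functional iota Z t u <=
    t `^ (- theta) * K_functional iota Y t u by lra.
  by rewrite ler_wpM2l ?powR_ge0// K_functional_subset// ltW.
- move=> t t0; exists (t `^ (- theta) * K_functional iota Z t u) => n.
  by rewrite expr1n mul1r.
Qed.

Lemma same_normed_space_of_le (D E' : set X0) (N N' : X0 -> \bar R) (C : R) :
  D = E' -> 0 < C -> (forall u, D u -> (N' u <= N u)%E) ->
  (forall u, D u -> (N u <= C%:E * N' u)%E) -> same_normed_space D N E' N'.
Proof.
move=> DE C0 N'N NN'; split => //; exists C^-1, 1; split; rewrite ?invr_gt0//.
by move=> u Du; rewrite lee_pdivrMl// mul1e NN'// N'N.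
Qed.

(** Above [theta0], an element [u] of trace 0 differs from one with the right
    decay by some [x] in [S], whose K-functional is at most [t] times its norm;
    so [u] itself has this decay, as the norm comparison requires. *)
Lemma interp_space_subspace theta (p : \bar R) : 0 < theta < 1 -> theta != theta0 ->
  continuous iota -> (1 <= p)%E ->
  let E := interp_space iota setT theta p in
  let normE := interp_norm iota setT theta p in
  let ES := interp_space iota [set x : X1 | x \in S] theta p in
  let normES := interp_norm iota [set x : X1 | x \in S] theta p in
  (theta < theta0 -> same_normed_space ES normES E normE) /\
  (theta0 < theta ->
    same_normed_space ES normES (E `&` [set u | trace u = 0]) normE).
Proof.
move=> th01 thN iota_cont p1 E normE ES normES.
have [L L1 iotaL] := continuous_linear_nrm iota_cont.
have [C C0 CP] := interp_norm_subspace_le L1 iotaL S_order theta0_itv th01 thN p1.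
have EES u : (normE u <= normES u)%E by exact: interp_norm_subset.
have ESE u : ES u -> E u by move=> uES; exact: le_lt_trans (EES u) uES.
have EtoES u : (normES u <= C%:E * normE u)%E -> E u -> ES u.
  move=> le Eu; apply: le_lt_trans le _.
  by apply: lte_mul_pinfty; rewrite ?lee_fin ?ltW.
split => [lt|gt].
  have le u : (normES u <= C%:E * normE u)%E.
    by apply: CP => gt; have := lt_trans lt gt; rewrite ltxx.
  apply: (same_normed_space_of_le _ C0) => //.
  by apply/seteqP; split => u; [exact: ESE|exact: EtoES (le u)].
have th01' : theta0 < theta < 1 by have /andP[_ ->] := th01; rewrite gt.
have KSle u : ES u -> exists M, forall t, 0 < t <= 1 -> KS t u <= M * t `^ theta.
  move=> /(interp_spaceP S0 th01 p1)[M _ uM].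
  by exists M => t /andP[t0 _]; exact: uM.
have ESker u : ES u -> trace u = 0.
  move=> /KSle[M uM]; apply: trace_relE; exists 0; first exact: qproj0.
  by rewrite linear0 subr0; exists theta, M.
have kerle u : E u -> trace u = 0 -> (normES u <= C%:E * normE u)%E.
  move=> Eu u0; apply: CP => _.
  have [x xu [M uM]] := trace_rel_exists th01' p1 Eu.
  have xS : x \in S.
    by rewrite -(subr0 x); apply/qproj_eq; rewrite xu u0 qproj0.
  (* The modulus of 1 comes from using linearity with scalar 1. *)
  exists (real_value `|1 : scalars R k| * M + nrm x) => t /[dup] t01 /andP[t0 t1].
  have {1}-> : u = 1 *: (u - iota x) + iota x by rewrite scale1r subrK.
  apply: le_trans (K_functional_linear iota S 1 _ _ (ltW t0)) _.
  rewrite mulrDl -mulrA; apply: lerD.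
    by rewrite ler_wpM2l ?real_value_norm_ge0// uM.
  rewrite -[iota x]add0r; apply: le_trans (K_functional_le _ _ (ltW t0) xS) _.
  rewrite nrm0 add0r mulrC ler_wpM2l ?nrm_ge0//.
  by have /andP[_ th1] := th01; apply: ger1_powR => //; exact: ltW.
apply: (same_normed_space_of_le _ C0) => //.
- apply/seteqP; split => u => [uES|[Eu u0]].
    by split; [exact: ESE|exact: ESker].
  exact: EtoES (kerle u Eu u0) Eu.
- by move=> u uES; apply: kerle; [exact: ESE|exact: ESker].
Qed.

End Trace.

Theorem theorem3p3 (R : realType) (k : scalar_kind)
    (X0 X1 : completeNormedModType (scalars R k))
    (iota : {linear X1 -> X0}) (S : submodClosed X1)
    (theta0 : R) (p : \bar R)
    (iota_inj : injective iota) (iota_cont : continuous iota)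
    (S_closed : closed [set x : X1 | x \in S])
    (theta0_itv : 0 < theta0 < 1) (p_ge1 : (1 <= p)%E)
    (S_order : exactly_of_order iota S theta0) :
  exists P : X0 -> quotient_space S,
    (forall theta : R, theta0 < theta < 1 ->
       continuous_linear_extension iota theta p P) /\
    (forall theta : R, 0 < theta < 1 -> theta != theta0 ->
       let E := interp_space iota setT theta p in
       let normE := interp_norm iota setT theta p in
       let ES := interp_space iota [set x : X1 | x \in S] theta p in
       let normES := interp_norm iota [set x : X1 | x \in S] theta p in
       (theta < theta0 -> same_normed_space ES normES E normE) /\
       (theta0 < theta ->
          same_normed_space ES normES (E `&` [set u | P u = 0]) normE)).
Proof.
exists (trace iota S theta0); split=> [theta th01|theta th01 thN].
  exact: trace_continuous_linear_extension.
exact: interp_space_subspace.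
Qed.
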